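(* Let $\Gamma$ be a finite graph and let $n\ge 5$. (1) Suppose $\Gamma$ is triangle-free. If $A(C_n)$ embeds into $A(\Gamma)$, then $\Gamma$ contains an induced subgraph isomorphic to $C_m$ for some $5\le m\le n$. (2) Suppose $\Gamma$ is bipartite. If $\Lambda$ is a finite graph and $A(\Lambda)$ embeds into $A(\Gamma)$, then $\Lambda$ is bipartite.
   Context: A graph is a simplicial 1-complex (no loops, no multi-edges). For a graph $\Gamma$ with vertex set $V(\Gamma)$ and edge set $E(\Gamma)$, the right-angled Artin group is $A(\Gamma)=\langle V(\Gamma)\mid [v,v']=1 \text{ for each } \{v,v'\}\in E(\Gamma)\rangle$. $C_n$ denotes the cycle of length $n$. A graph is triangle-free if it contains no cycle of length three. A group $H$ embeds into $G$ if there is an injective homomorphism $H\to G$. *)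

(* Defs.v *)
From HB Require Import structures.
From mathcomp Require Import all_boot.
From mathcomp Require Import boolp.

Set Implicit Arguments.
Unset Strict Implicit.
Unset Printing Implicit Defensive.

Local Open Scope quotient_scope.

Record sgraph := SGraph {
  vertex :> finType;
  adj : rel vertex;
  adj_sym : symmetric adj;
  adj_irrefl : irreflexive adj
}.

Definition graph_iso (G H : sgraph) : Prop :=
  exists2 f : G -> H, bijective f & {mono f : x y / adj x y}.

Section InducedSubgraph.
Variables (G : sgraph) (S : {set G}).

Definition induced_adj : rel {x : G | x \in S} := fun x y => adj (val x) (val y).

Fact induced_adj_sym : symmetric induced_adj.
Proof. by move=> x y; exact: adj_sym. Qed.

Fact induced_adj_irrefl : irreflexive induced_adj.
Proof. by move=> x; exact: adj_irrefl. Qed.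

Definition induced : sgraph := SGraph induced_adj_sym induced_adj_irrefl.

End InducedSubgraph.

Section CycleGraph.
Variable n : nat.

(* The cycle of length n for n >= 3; the conjunct i != j only matters for      *)
(* n = 1, where i + 1 = i modulo n.                                            *)
Definition cycle_adj : rel 'I_n :=
  fun i j => (i != j) && ((j == ordS i) || (i == ordS j)).

Fact cycle_adj_sym : symmetric cycle_adj.
Proof. by move=> i j; rewrite /cycle_adj eq_sym orbC. Qed.

Fact cycle_adj_irrefl : irreflexive cycle_adj.
Proof. by move=> i; rewrite /cycle_adj eqxx. Qed.

Definition cycle_graph : sgraph := SGraph cycle_adj_sym cycle_adj_irrefl.

End CycleGraph.

Definition triangle_free (G : sgraph) : Prop :=
  forall c : seq G, ucycle (@adj G) c -> size c != 3.

Definition bipartite (G : sgraph) : Prop :=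
  exists side : G -> bool, forall x y : G, adj x y -> side x != side y.

Section Presentation.
Variable X : choiceType.

(* The letter (x, false) stands for x and (x, true) for its formal inverse.    *)
Definition letter : Type := (X * bool)%type.
Definition word : Type := seq letter.

Definition inv_letter (l : letter) : letter := (l.1, ~~ l.2).
Definition inv_word (w : word) : word := rev (map inv_letter w).

Variable rels : word -> Prop.

(* The smallest congruence on words that cancels adjacent inverse letters and  *)
(* kills the relators: its classes are the elements of the quotient of the     *)
(* free group on X by the normal closure of rels.                              *)
Inductive word_eq : word -> word -> Prop :=
| word_eq_refl u : word_eq u u
| word_eq_sym u v : word_eq u v -> word_eq v u
| word_eq_trans u v w : word_eq u v -> word_eq v w -> word_eq u w
| word_eq_cat u u' v v' :
    word_eq u u' -> word_eq v v' -> word_eq (u ++ v) (u' ++ v')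
| word_eq_cancel l : word_eq [:: l; inv_letter l] [::]
| word_eq_rel r : rels r -> word_eq r [::].

(* Word equality is made boolean classically: {eq_quot _} needs a boolean      *)
(* relation and groupType a choiceType.                                        *)
Definition word_eqb : rel word := fun u v => `[< word_eq u v >].

Fact word_eqb_refl : reflexive word_eqb.
Proof. by move=> u; apply/asboolP; exact: word_eq_refl. Qed.

Fact word_eqb_sym : symmetric word_eqb.
Proof. by move=> u v; apply/asboolP/asboolP; exact: word_eq_sym. Qed.

Fact word_eqb_trans : transitive word_eqb.
Proof.
move=> v u w /asboolP uv /asboolP vw; apply/asboolP.
exact: word_eq_trans uv vw.
Qed.

Canonical word_equiv := EquivRel word_eqb word_eqb_refl word_eqb_sym word_eqb_trans.

Definition presented : Type := {eq_quot word_equiv}.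

HB.instance Definition _ := Choice.on presented.
HB.instance Definition _ := EqQuotient.on presented.

Definition class_of (w : word) : presented := \pi_presented w.

Fact class_ofP u v : class_of u = class_of v <-> word_eq u v.
Proof.
split=> [/(@eqmodP _ word_equiv) /asboolP //|uv].
by apply/(@eqmodP _ word_equiv); exact/asboolP.
Qed.

Definition pres_one : presented := class_of [::].
Definition pres_mul (a b : presented) : presented := class_of (repr a ++ repr b).
Definition pres_inv (a : presented) : presented := class_of (inv_word (repr a)).

Fact class_of_repr (a : presented) : class_of (repr a) = a.
Proof. exact: reprK. Qed.

Fact repr_class_of w : word_eq (repr (class_of w)) w.
Proof. by apply/class_ofP; rewrite class_of_repr. Qed.

Fact word_eq_mulV w : word_eq (w ++ inv_word w) [::].
Proof.
elim: w => [|l w IHw]; first exact: word_eq_refl.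
have -> : (l :: w) ++ inv_word (l :: w)
    = [:: l] ++ ((w ++ inv_word w) ++ [:: inv_letter l]).
  by rewrite /inv_word /= rev_cons -cats1 -catA.
apply: word_eq_trans (word_eq_cancel l); apply: word_eq_cat (word_eq_refl _) _.
exact: word_eq_cat IHw (word_eq_refl _).
Qed.

Fact inv_wordK : involutive inv_word.
Proof.
move=> w; rewrite /inv_word map_rev revK -map_comp map_id_in //.
by move=> [x b] _; rewrite /= /inv_letter /= negbK.
Qed.

Fact pres_mulA : associative pres_mul.
Proof.
move=> a b c; apply/class_ofP.
apply: (@word_eq_trans _ (repr a ++ (repr b ++ repr c))).
  by apply: word_eq_cat; [exact: word_eq_refl | exact: repr_class_of].
rewrite catA; apply: word_eq_cat; last exact: word_eq_refl.
by apply: word_eq_sym; exact: repr_class_of.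
Qed.

Fact pres_mul1 : left_id pres_one pres_mul.
Proof.
move=> a; rewrite -[RHS]class_of_repr; apply/class_ofP.
by apply: (word_eq_cat (u' := [::])); [exact: repr_class_of | exact: word_eq_refl].
Qed.

Fact pres_mulr1 : right_id pres_one pres_mul.
Proof.
move=> a; rewrite -[RHS]class_of_repr; apply/class_ofP.
rewrite -[X in word_eq _ X]cats0.
by apply: word_eq_cat; [exact: word_eq_refl | exact: repr_class_of].
Qed.

Fact pres_mulV : left_inverse pres_one pres_inv pres_mul.
Proof.
move=> a; apply/class_ofP.
apply: (@word_eq_trans _ (inv_word (repr a) ++ repr a)).
  by apply: word_eq_cat; [exact: repr_class_of | exact: word_eq_refl].
by rewrite -{2}[repr a]inv_wordK; exact: word_eq_mulV.
Qed.

Fact pres_mulrV : right_inverse pres_one pres_inv pres_mul.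
Proof.
move=> a; apply/class_ofP.
apply: (@word_eq_trans _ (repr a ++ inv_word (repr a))).
  by apply: word_eq_cat; [exact: word_eq_refl | exact: repr_class_of].
exact: word_eq_mulV.
Qed.

HB.instance Definition _ :=
  isGroup.Build presented pres_mulA pres_mul1 pres_mulr1 pres_mulV pres_mulrV.

End Presentation.

Definition commutator_word (X : choiceType) (x y : X) : word X :=
  [:: (x, true); (y, true); (x, false); (y, false)].

Definition raag_rels (G : sgraph) (w : word G) : Prop :=
  exists x y : G, adj x y /\ w = commutator_word x y.

Definition raag (G : sgraph) : Type := presented (@raag_rels G).

HB.instance Definition _ (G : sgraph) := Group.on (raag G).

Definition embeds (H G : groupType) : Prop :=
  exists f : {multiplicative H -> G}, injective f.

(* Main.v *)
(* The vertex [a] of [G] defines walls in the Cayley graph of A(G): the wall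
   dual to the edge from [h] to [h a] is the coset [h <lk a>], and crossing
   parity shows that it separates the Cayley graph in two halfspaces. Two walls
   all of whose quadrants are nonempty cross along a square, so their types are
   adjacent; hence walls of the same type are nested.

   An element [g] skews a wall if it maps one of its halfspaces strictly into
   itself; [g] is a product of conjugates of generators dual to walls it skews.
   An element commuting with [g] permutes the walls of a given type skewed by
   [g], which form discrete chains, so some power of it agrees on such a chain
   with a power of [g]. If G is triangle-free and [g_0, ..., g_(n-1)] is the image
   of an induced n-cycle, n >= 5, this forces every wall skewed by [g_(i+1)] to
   cross every wall skewed by [g_i]. The walls of the [g_i] thus give sets [S_i] of
   vertices of the extension graph (conjugates of generators), consecutive ones
   completely joined and no others. Among such families of length between 5 and
   n, a minimal one consists of singletons, that is, of an induced cycle of the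
   extension graph. Folding this cycle along walls until all its vertices are
   generators puts it inside G.

   For bipartite G, the types of the [S_i] would yield an odd closed walk in G
   as soon as the other graph has an induced odd cycle of length at least 5;
   a triangle is excluded in the same way by following three commuting
   elements. *)

Require Import Defs.
From mathcomp Require Import all_boot.
From mathcomp Require Import boolp.
From mathcomp Require Import ssralg ssrint zify.

Set Implicit Arguments.
Unset Strict Implicit.
Unset Printing Implicit Defensive.

Local Open Scope group_scope.

(** * Walls and halfspaces *)

Section Walls.
Variable G : sgraph.
Local Notation T := (raag G).
Implicit Types (P : pred G) (g h k : T) (l m : letter G) (w : word G) (a b : G).

Definition ev (w : word G) : T := class_of (@raag_rels G) w.
Definition gen (l : letter G) : T := ev [:: l].

Lemma ev_nil : ev [::] = 1.
Proof. by []. Qed.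

Lemma ev_cat u v : ev (u ++ v) = ev u * ev v.
Proof.
apply/class_ofP; apply: word_eq_sym.
by apply: word_eq_cat; apply: repr_class_of.
Qed.

Lemma ev_cons l w : ev (l :: w) = gen l * ev w.
Proof. by rewrite -cat1s ev_cat. Qed.

Lemma ev_rcons w l : ev (rcons w l) = ev w * gen l.
Proof. by rewrite -cats1 ev_cat. Qed.

Lemma ev_surj g : exists w, g = ev w.
Proof. by exists (repr g); rewrite /ev class_of_repr. Qed.

Lemma inv_letterK : involutive (@inv_letter G).
Proof. by case=> a b; rewrite /inv_letter /= negbK. Qed.

Lemma inv_letter_neq l : (inv_letter l == l) = false.
Proof. by apply/eqP; case: l => a [] []. Qed.

Lemma gen_inv l : gen (inv_letter l) = (gen l)^-1.
Proof.
apply/esym/mulg1_eq; rewrite -ev_cons.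
by apply/class_ofP; apply: word_eq_cancel.
Qed.

Lemma gen_sign l :
  gen l = if l.2 then (gen (l.1, false))^-1 else gen (l.1, false).
Proof. by case: l => a [] //=; rewrite -gen_inv. Qed.

Lemma gen_comm l m : adj l.1 m.1 -> commute (gen l) (gen m).
Proof.
have pos a b : adj a b -> commute (gen (a, false)) (gen (b, false)).
  move=> ab; have : ev (commutator_word a b) = 1.
    by apply/class_ofP; apply: word_eq_rel; exists a, b.
  rewrite /commutator_word !ev_cons ev_nil.
  rewrite -[(a, true)]/(inv_letter (a, false)) -[(b, true)]/(inv_letter (b, false)).
  rewrite !gen_inv mulg1 !mulgA -invgM => /mulg1_eq.
  by rewrite !invgM !invgK => H; rewrite /commute -{1}H mulVKg.
move=> /pos lm; rewrite (gen_sign l) (gen_sign m).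
by do 2![case: ifP => _]; rewrite /commute //; do ?
  [exact: lm | apply: commuteV | apply: commute_sym].
Qed.

Lemma gen_comm_same l m : l.1 = m.1 -> commute (gen l) (gen m).
Proof.
move=> lm; rewrite (gen_sign l) (gen_sign m) lm.
by do 2![case: ifP => _]; do ?
  [exact: commute_refl | apply: commuteV | apply/commute_sym/commuteV].
Qed.

(** * Subgroups generated by sets of vertices, and exponent sums *)

Definition star a : pred G := fun b => (b == a) || adj a b.

Definition gen_by (P : pred G) g : Prop :=
  exists2 w, all (fun l => P l.1) w & g = ev w.

Lemma gen_by1 P : gen_by P 1.
Proof. by exists [::]. Qed.

Lemma gen_by_gen P l : P l.1 -> gen_by P (gen l).
Proof. by move=> Pl; exists [:: l]; rewrite /= ?Pl. Qed.

Lemma gen_byM P g h : gen_by P g -> gen_by P h -> gen_by P (g * h).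
Proof.
by case=> u Pu -> [v Pv ->]; exists (u ++ v); rewrite ?all_cat ?Pu ?ev_cat.
Qed.

Lemma gen_byV P g : gen_by P g -> gen_by P g^-1.
Proof.
case=> u Pu ->; elim: u Pu => [|l u IHu] /=; first by rewrite invg1 => _; apply: gen_by1.
case/andP=> Pl /IHu Pu; rewrite ev_cons invgM; apply: gen_byM => //.
by rewrite -gen_inv; apply: gen_by_gen.
Qed.

Lemma gen_byMl P g h : gen_by P g -> gen_by P (g * h) <-> gen_by P h.
Proof.
move=> Pg; split; last exact: gen_byM.
by move/(gen_byM (gen_byV Pg)); rewrite mulKg.
Qed.

Lemma gen_byMr P g h : gen_by P h -> gen_by P (g * h) <-> gen_by P g.
Proof.
move=> Ph; split; last by move=> Pg; apply: gen_byM.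
by move/gen_byM => /(_ _ (gen_byV Ph)); rewrite mulgK.
Qed.

Lemma gen_byX P g n : gen_by P g -> gen_by P (g ^+ n).
Proof.
move=> Pg; elim: n => [|n IHn]; first exact: gen_by1.
by rewrite expgS; apply: gen_byM.
Qed.

Lemma gen_by_comm P g k :
  (forall l, P l.1 -> commute (gen l) k) -> gen_by P g -> commute g k.
Proof.
move=> Pk [w Pw ->]; elim: w Pw => [_|l w IHw] /=.
  by apply: commute_sym; apply: commute1.
case/andP=> /Pk lk /IHw wk; rewrite ev_cons; apply: commute_sym.
by apply: commuteM; apply: commute_sym.
Qed.

Lemma link_comm l g : gen_by (adj l.1) g -> commute g (gen l).
Proof. by apply: gen_by_comm => m lm; apply: gen_comm; rewrite adj_sym. Qed.

Definition expo a w : int :=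
  (count_mem (a, false) w)%:Z - (count_mem (a, true) w)%:Z.

Lemma expo_cat a u v : expo a (u ++ v) = (expo a u + expo a v)%R.
Proof. by rewrite /expo !count_cat; lia. Qed.

Lemma expo_word_eq a u v : word_eq (@raag_rels G) u v -> expo a u = expo a v.
Proof.
elim=> //.
- by move=> ? ? ? ? -> ? ->.
- by move=> ? ? ? ? ? e1 ? e2; rewrite !expo_cat e1 e2.
- by case=> x b; rewrite /expo /inv_letter /= !xpair_eqE; case: b; case: (x == a).
- move=> r [x [y [_ ->]]]; rewrite /expo /commutator_word /= !xpair_eqE.
  by case: (x == a); case: (y == a).
Qed.

(** The [a]-coordinate of the abelianization. *)
Definition ab a g : int := expo a (repr g).

Lemma ab_ev a w : ab a (ev w) = expo a w.
Proof. by apply: expo_word_eq; apply: repr_class_of. Qed.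

Lemma abM a g h : ab a (g * h) = (ab a g + ab a h)%R.
Proof.
by have [u ->] := ev_surj g; have [v ->] := ev_surj h; rewrite -ev_cat !ab_ev expo_cat.
Qed.

Lemma ab1 a : ab a 1 = 0%R.
Proof. by rewrite -ev_nil ab_ev. Qed.

Lemma abV a g : ab a g^-1 = (- ab a g)%R.
Proof. by have := abM a g g^-1; rewrite mulgV ab1; lia. Qed.

Lemma abX a g n : ab a (g ^+ n) = (n%:Z * ab a g)%R.
Proof.
elim: n => [|n IHn]; first by rewrite expg0 ab1; lia.
by rewrite expgS abM IHn; lia.
Qed.

Lemma ab_gen a l : ab a (gen l) =
  (if l.1 == a then if l.2 then -1 else 1 else 0)%R.
Proof. by rewrite ab_ev /expo /=; case: l => x []; rewrite !xpair_eqE; case: eqP. Qed.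

Lemma ab_gen_by P a g : gen_by P g -> ~~ P a -> ab a g = 0%R.
Proof.
case=> w Pw -> nPa; elim: w Pw => [|l w IHw] /=; first by rewrite ev_nil ab1.
case/andP=> Pl /IHw abw; rewrite ev_cons abM abw ab_gen.
by case: eqP => // la; rewrite -la Pl in nPa.
Qed.

Lemma gen_notin_link l : ~ gen_by (adj l.1) (gen l).
Proof.
move=> /ab_gen_by/(_ (negbT (adj_irrefl l.1))); rewrite ab_gen eqxx.
by case: l.2.
Qed.

(* The edge from [g] to [g * gen m] of the Cayley graph is dual to the wall of
   the edge from [1] to [gen l]. *)
Definition cross l g m : bool :=
  ((m == l) && `[< gen_by (adj l.1) g >])
  || ((m == inv_letter l) && `[< gen_by (adj l.1) (g * gen m) >]).

Fixpoint crosses l g w : bool :=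
  if w is m :: w' then cross l g m (+) crosses l (g * gen m) w' else false.

Lemma crosses_cat l g u v :
  crosses l g (u ++ v) = crosses l g u (+) crosses l (g * ev u) v.
Proof.
elim: u g => [|m u IHu] g /=; first by rewrite mulg1.
by rewrite IHu ev_cons mulgA addbA.
Qed.

Lemma cross_other l g m : m.1 != l.1 -> cross l g m = false.
Proof.
move=> ml; rewrite /cross.
have -> : (m == l) = false by apply: contraNF ml => /eqP->.
by have -> : (m == inv_letter l) = false by apply: contraNF ml => /eqP->.
Qed.

Lemma cross_link l g h m : gen_by (adj l.1) h -> cross l (h * g) m = cross l g m.
Proof.
move=> lh; rewrite /cross; congr ((_ && _) || (_ && _)); apply/asbool_equiv_eq.
  exact: gen_byMl.
by rewrite -mulgA; exact: gen_byMl.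
Qed.

Lemma cross_commute l g m n :
  gen_by (adj l.1) (gen n) -> commute (gen n) (gen m) ->
  cross l (g * gen n) m = cross l g m.
Proof.
move=> ln nm; rewrite /cross; congr ((_ && _) || (_ && _)); apply/asbool_equiv_eq.
  exact: gen_byMr.
by rewrite -mulgA nm mulgA; exact: gen_byMr.
Qed.

Lemma cross_back l g m : cross l (g * gen m) (inv_letter m) = cross l g m.
Proof.
rewrite /cross gen_inv mulgK -[in inv_letter m == inv_letter l](inj_eq (inv_inj inv_letterK)).
rewrite !inv_letterK -[in LHS](inj_eq (inv_inj inv_letterK)) inv_letterK orbC.
by congr ((_ && _) || _).
Qed.

(** Opposite edges of a commutation square are dual to the same wall, so a path around the square
    crosses each wall an even number of times. *)
Lemma crosses_word_eq l u v :
  word_eq (@raag_rels G) u v -> forall g, crosses l g u = crosses l g v.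
Proof.
elim=> // {u v}.
- by move=> u v w _ IHu _ IHv g; rewrite IHu IHv.
- move=> u u' v v' /class_ofP uu' IHu _ IHv g; rewrite !crosses_cat IHu.
  by rewrite (_ : ev u = ev u') ?IHv.
- by move=> m g /=; rewrite cross_back addbF addbb.
- move=> r [x [y [xy ->]]] g /=; rewrite addbF.
  have xy' s t : commute (gen (x, s)) (gen (y, t)) by apply: gen_comm.
  have yx' s t : commute (gen (y, s)) (gen (x, t)) by apply: gen_comm; rewrite adj_sym.
  have ny : y != x by apply: contraTneq xy => ->; rewrite adj_irrefl.
  have E1 : g * gen (x, true) * gen (y, true) * gen (x, false) = g * gen (y, true).
    by rewrite -[_ * gen (x, false)]mulgA yx' mulgA
      -[(x, true)]/(inv_letter (x, false)) gen_inv mulgVK.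
  rewrite E1.
  have bk z : cross l (g * gen (z, true)) (z, false) = cross l g (z, true).
    exact: cross_back.
  have [lx|] := eqVneq x l.1.
    rewrite !(@cross_other _ _ (y, _)) /= -?lx //.
    rewrite (@cross_commute _ _ _ (y, true)) ?bk ?addbF ?addbb //.
    by apply: gen_by_gen; rewrite -lx.
  move=> nx; rewrite !(@cross_other _ _ (x, _)) //= bk.
  have [ly|ny'] := eqVneq y l.1.
    rewrite (@cross_commute _ _ _ (x, true)) ?addbb //.
    by apply: gen_by_gen; rewrite -ly /= adj_sym.
  by rewrite !cross_other.
Qed.

Definition hs l g : bool := crosses l 1 (repr g).

Lemma hs_ev l w : hs l (ev w) = crosses l 1 w.
Proof. by apply: crosses_word_eq; apply: repr_class_of. Qed.

Lemma hs1 l : hs l 1 = false.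
Proof. by rewrite -ev_nil hs_ev. Qed.

Lemma hs_step l g m : hs l (g * gen m) = hs l g (+) cross l g m.
Proof.
have [w ->] := ev_surj g.
by rewrite -ev_cat !hs_ev crosses_cat mul1g /= addbF.
Qed.

Lemma hs_link l g h : gen_by (adj l.1) h -> hs l (h * g) = hs l g.
Proof.
move=> lh; have [w ->] := ev_surj g; elim/last_ind: w => [|w m IHw]; last first.
  by rewrite ev_rcons mulgA !hs_step IHw cross_link.
rewrite ev_nil mulg1 hs1; case: lh => w; elim/last_ind: w h => [|w m IHw] h.
  by move=> _ ->; rewrite hs1.
rewrite all_rcons => /andP[lm lw] ->; rewrite ev_rcons hs_step (IHw (ev w)) //.
by rewrite cross_other //; apply: contraTneq lm => ->; rewrite adj_irrefl.
Qed.

Lemma hs_gen l : hs l (gen l) = true.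
Proof.
rewrite -[gen l]mul1g hs_step hs1 /cross eqxx.
by have -> : `[<gen_by (adj l.1) 1>] by apply/asboolP/gen_by1.
Qed.

Lemma hs_enter l g m :
  ~~ hs l g -> hs l (g * gen m) -> m = l /\ gen_by (adj l.1) g.
Proof.
move=> ng; rewrite hs_step (negPf ng) addFb => /orP[/andP[/eqP-> /asboolP]|] //.
case/andP=> /eqP-> /asboolP lg; case/negP: ng.
by rewrite -[g](mulgK (gen (inv_letter l))) -gen_inv inv_letterK hs_link // hs_gen.
Qed.

Lemma hs_leave l g m :
  hs l g -> ~~ hs l (g * gen m) -> m = inv_letter l /\ gen_by (adj l.1) (g * gen m).
Proof.
move=> Hg nHg; have [||<- //] := @hs_enter l (g * gen m) (inv_letter m) => //.
  by rewrite gen_inv mulgK.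
by rewrite inv_letterK.
Qed.

(** The pair [(h, l)] is an oriented edge and stands for the side of its wall containing
    [h * gen l]. Several pairs may describe the same side, so halfspaces are compared by
    [ins H =1 ins K]. *)
Definition halfspace := (T * letter G)%type.
Implicit Types (H K : halfspace).

Definition ins H k : bool := hs H.2 (H.1^-1 * k).
Definition tr g H : halfspace := (g * H.1, H.2).
Definition opp H : halfspace := (H.1 * gen H.2, inv_letter H.2).
Definition axis H : T := H.1 * gen H.2 * H.1^-1.

Lemma ins_tr g H k : ins (tr g H) k = ins H (g^-1 * k).
Proof. by rewrite /ins /= invgM mulgA. Qed.

Lemma ins_base H : ins H H.1 = false.
Proof. by rewrite /ins mulVg hs1. Qed.

Lemma ins_end H : ins H (H.1 * gen H.2).
Proof. by rewrite /ins mulKg hs_gen. Qed.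

Lemma ins_enter H k m :
  ~~ ins H k -> ins H (k * gen m) -> m = H.2 /\ gen_by (adj H.2.1) (H.1^-1 * k).
Proof. by rewrite /ins mulgA; apply: hs_enter. Qed.

Lemma ins_leave H k m :
  ins H k -> ~~ ins H (k * gen m) ->
  m = inv_letter H.2 /\ gen_by (adj H.2.1) (H.1^-1 * (k * gen m)).
Proof.
by rewrite /ins mulgA; apply: hs_leave.
Qed.

Lemma link_conj l g :
  gen_by (adj l.1) ((gen l)^-1 * g) <-> gen_by (adj l.1) (g * (gen l)^-1).
Proof.
split=> lg; have lc := link_comm lg.
  by rewrite -[g](mulVKg (gen l)) -lc mulgK.
by rewrite -[g](mulgVK (gen l)) lc mulKg.
Qed.

Lemma hs_opp l g : hs (inv_letter l) ((gen l)^-1 * g) = ~~ hs l g.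
Proof.
have [w ->] := ev_surj g; elim/last_ind: w => [|w m IHw].
  by rewrite ev_nil mulg1 -gen_inv hs_gen hs1.
rewrite ev_rcons mulgA !hs_step IHw -addNb; congr (_ (+) _); rewrite /cross inv_letterK orbC /=.
congr (_ || _); case: eqP => //= ->; apply/asbool_equiv_eq.
  by have := link_conj l (ev w * gen l); rewrite mulgK mulgA.
by rewrite gen_inv; exact: link_conj.
Qed.

Lemma ins_opp H k : ins (opp H) k = ~~ ins H k.
Proof. by rewrite /ins /= invgM -mulgA hs_opp. Qed.

Lemma ins_eq H K :
  H.2 = K.2 -> gen_by (adj H.2.1) (H.1^-1 * K.1) -> ins H =1 ins K.
Proof.
move=> E lHK k; rewrite /ins -E -[in RHS](hs_link _ lHK).
by rewrite -mulgA mulVKg.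
Qed.

Lemma ins_edge H K k m :
  ~~ ins H k -> ins H (k * gen m) -> ~~ ins K k -> ins K (k * gen m) ->
  ins H =1 ins K.
Proof.
move=> H1 H2 K1 K2; have [mH lH] := ins_enter H1 H2; have [mK lK] := ins_enter K1 K2.
apply: ins_eq; first by rewrite -mH -mK.
have -> : H.1^-1 * K.1 = (H.1^-1 * k) * (K.1^-1 * k)^-1 by rewrite !gnorm.
by apply: gen_byM => //; apply: gen_byV; rewrite -mH mK.
Qed.

Lemma path_enter (P : T -> bool) k w : ~~ P k -> P (k * ev w) ->
  exists w1 m w2, [/\ w = w1 ++ m :: w2, ~~ P (k * ev w1) & P (k * ev w1 * gen m)].
Proof.
elim/last_ind: w => [|w m IHw] nPk; first by rewrite ev_nil mulg1 (negPf nPk).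
rewrite ev_rcons mulgA; have [Pw _|nPw Pwm] := boolP (P (k * ev w)).
  have [w1 [m' [w2 [-> H1 H2]]]] := IHw nPk Pw.
  by exists w1, m', (rcons w2 m); rewrite rcons_cat.
by exists w, m, [::]; rewrite cats1.
Qed.

(** Otherwise no edge inside [H] would cross the wall of [K], and by connectedness membership in [K]
    would be constant on [H]. *)
Lemma boundary_meets H K k1 k2 :
  ins H k1 -> ins K k1 -> ins H k2 -> ~~ ins K k2 ->
  exists2 p, gen_by (adj K.2.1) (K.1^-1 * p) & ins H p.
Proof.
move=> H1 K1 H2 K2; apply: contrapT => nex.
have edge k m : ins H k -> ins H (k * gen m) -> ins K (k * gen m) = ins K k.
  move=> Hk Hkm; have [Kk|nKk] := boolP (ins K k);
    have [Kkm|nKkm] := boolP (ins K (k * gen m)) => //.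
    by have [_ lK] := ins_leave Kk nKkm; case: nex; exists (k * gen m).
  by have [_ lK] := ins_enter nKk Kkm; case: nex; exists k.
set b := H.1 * gen H.2.
have near u : all (fun l => adj H.2.1 l.1) u -> ins H (b * ev u) /\ ins K (b * ev u) = ins K b.
  elim/last_ind: u => [|u m IHu]; first by rewrite ev_nil mulg1 ins_end.
  rewrite all_rcons => /andP[lm lu]; have [Hu Ku] := IHu lu.
  suff Hum : ins H (b * ev (rcons u m)) by rewrite -Ku ev_rcons mulgA edge // -mulgA -ev_rcons.
  have lum : gen_by (adj H.2.1) (ev (rcons u m)) by exists (rcons u m); rewrite // all_rcons lm.
  by rewrite /ins /b -mulgA mulKg -(link_comm lum) hs_link // hs_gen.
(* A path may wander out of [H], but it comes back at a point of [b] times the link subgroup, where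
   [near] applies. *)
have all_same w : ins H (b * ev w) -> ins K (b * ev w) = ins K b.
  elim/last_ind: w => [|w m IHw]; first by rewrite ev_nil mulg1.
  rewrite ev_rcons mulgA => Hwm.
  have [Hw|nHw] := boolP (ins H (b * ev w)); first by rewrite edge // IHw.
  have [-> lH] := ins_enter nHw Hwm.
  have [u lu E] := lH; have -> : b * ev w * gen H.2 = b * ev u.
    by rewrite -E /b -[RHS]mulgA -(link_comm lH) !gnorm.
  by have [] := near u lu.
have [w1 E1] := ev_surj (b^-1 * k1); have [w2 E2] := ev_surj (b^-1 * k2).
have := all_same w1; have := all_same w2.
by rewrite -E1 -E2 !mulVKg K1 (negPf K2) => <- // /(_ H1).
Qed.

(** The boundary coset of [K] has points on both sides of [H]. A word in the link of [K.2] joining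
    them enters [H] along an edge labelled [H.2], which gives both the adjacency and the common
    point. *)
Lemma crossing H K :
  (exists2 k, ins H k & ins K k) -> (exists2 k, ins H k & ~~ ins K k) ->
  (exists2 k, ~~ ins H k & ins K k) -> (exists2 k, ~~ ins H k & ~~ ins K k) ->
  exists g, [/\ gen_by (adj H.2.1) (H.1^-1 * g), gen_by (adj K.2.1) (K.1^-1 * g)
             & adj H.2.1 K.2.1].
Proof.
case=> k1 H1 K1 [k2 H2 K2] [k3 H3 K3] [k4 H4 K4].
have [p lp Hp] := boundary_meets H1 K1 H2 K2.
have [||||p' lp'] := @boundary_meets (opp H) K k3 k4; rewrite ?ins_opp // => nHp'.
have [w lw E] := gen_byM (gen_byV lp') lp.
have {}E : p'^-1 * p = ev w by rewrite -E !gnorm.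
have [|w1 [m [w2 [Ew nH Hm]]]] := @path_enter (ins H) p' w nHp'.
  by rewrite -E mulVKg.
move: lw; rewrite Ew all_cat /= => /and3P[lw1 lm _].
have [mH lH] := ins_enter nH Hm.
exists (p' * ev w1); split=> //; last by rewrite adj_sym -mH.
by rewrite mulgA; apply: gen_byM => //; exists w1.
Qed.

(** * Skewed walls *)

Lemma pigeonhole N (R : nat -> nat -> Prop) :
  (forall n, exists2 j, j < N & R n j) ->
  exists n1 n2 j, [/\ n1 < n2, R n1 j & R n2 j].
Proof.
move=> ex; have [f fP] := @choice _ _ (fun n j => j < N /\ R n j)
  (fun n => let: ex_intro2 j jN Rj := ex n in ex_intro _ j (conj jN Rj)).
pose F (i : 'I_N.+1) : 'I_N := Ordinal (proj1 (fP i)).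
have /injectivePn[x [y xy Fxy]] : ~~ injectiveb F.
  apply/injectiveP => /leq_card; rewrite !card_ord; lia.
have E : f x = f y by have := congr1 val Fxy.
have [lt|gt|/val_inj E'] := ltngtP x y.
- by exists x, y, (f x); split=> //; [exact: (fP x).2 | rewrite E; exact: (fP y).2].
- by exists y, x, (f x); split=> //; [rewrite E; exact: (fP y).2 | exact: (fP x).2].
- by rewrite E' eqxx in xy.
Qed.

(** A path from [k] to [k'] has finitely many edges and enters each [F n] along one of them; two
    halfspaces entered along the same edge coincide. *)
Lemma separating_finite (F : nat -> halfspace) k k' :
  (forall n, ~~ ins (F n) k) -> (forall n, ins (F n) k') ->
  exists n1 n2, n1 < n2 /\ ins (F n1) =1 ins (F n2).
Proof.
move=> Fk Fk'; have [w Ew] := ev_surj (k^-1 * k').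
pose edge j := (k * ev (take j w), nth ((F 0).2) w j).
have [n|n1 [n2 [j [lt [R1 R1'] [R2 R2']]]]] := @pigeonhole (size w)
  (fun n j => ~~ ins (F n) (edge j).1 /\ ins (F n) ((edge j).1 * gen (edge j).2)).
  have [||w1 [m [w2 [E nH Hm]]]] := @path_enter (ins (F n)) k w => //.
    by rewrite -Ew mulVKg.
  exists (size w1); first by rewrite E size_cat /=; lia.
  by rewrite /edge E take_size_cat // nth_cat ltnn subnn.
by exists n1, n2; split=> //; apply: ins_edge R1 R1' R2 R2'.
Qed.

(** As [ins H (g^-1 * k)] says that [k] is in the translate [g H], [fixes] is equality of [g H] and
    [H], and [skew] is strict inclusion. *)
Definition fixes g H := forall k, ins H (g^-1 * k) = ins H k.

Definition skew g H :=
  (forall k, ins H (g^-1 * k) -> ins H k)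
  /\ exists2 k, ins H k & ~~ ins H (g^-1 * k).

Lemma fixesV g H : fixes g H -> fixes g^-1 H.
Proof. by move=> gH k; rewrite invgK -[in RHS](mulKg g k) gH. Qed.

Lemma fixesM g h H : fixes g H -> fixes h H -> fixes (g * h) H.
Proof. by move=> gH hH k; rewrite invgM -mulgA hH gH. Qed.

Lemma fixesX g H n : fixes g H -> fixes (g ^+ n) H.
Proof.
move=> gH; elim: n => [|n IHn]; first by move=> k; rewrite expg0 invg1 mul1g.
by rewrite expgS; apply: fixesM.
Qed.

Lemma fixes_link g H : fixes g H -> gen_by (adj H.2.1) (H.1^-1 * g * H.1).
Proof.
move=> gH; have [||_] := @ins_enter H (g * H.1) H.2; last by rewrite mulgA.
  by rewrite -gH mulKg ins_base.
by rewrite -gH -mulgA mulKg ins_end.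
Qed.

Lemma skew_not_fixes g H : skew g H -> ~ fixes g H.
Proof. by case=> _ [k Hk nHk] gH; rewrite gH Hk in nHk. Qed.

Lemma skew_mono g H n k : skew g H -> ins H k -> ins H (g ^+ n * k).
Proof.
move=> [gH _] Hk; elim: n => [|n IHn]; first by rewrite expg0 mul1g.
by rewrite expgS -mulgA; apply: gH; rewrite mulKg.
Qed.

Lemma skew_monoV g H n k : skew g H -> ~~ ins H k -> ~~ ins H ((g ^+ n)^-1 * k).
Proof. by move=> gH; apply: contra => /(skew_mono n gH); rewrite mulVKg. Qed.

Lemma skewX g H n : 0 < n -> skew g H -> skew (g ^+ n) H.
Proof.
case: n => // n _ gH; split=> [k /(skew_mono n.+1 gH)|]; first by rewrite mulVKg.
have [_ [k Hk nHk]] := gH; exists k => //.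
by rewrite expgS invgM -mulgA; apply: skew_monoV.
Qed.

(** Otherwise the increasing halfspaces [g^-n H] would all separate [k] from a fixed point of [H];
    two of them would coincide, against strictness. *)
Lemma skew_in g H k : skew g H -> exists n, ins H (g ^+ n * k).
Proof.
move=> gH; have [gH1 [k' Hk' nHk']] := gH; apply: contrapT => nex.
pose F n := tr (g ^+ n)^-1 H.
have insF n x : ins (F n) x = ins H (g ^+ n * x) by rewrite ins_tr invgK.
have [n|n|n1 [n2 [lt E]]] := @separating_finite F k k'.
- by rewrite insF; apply/negP => Hk; apply: nex; exists n.
- by rewrite insF; apply: skew_mono.
have := E ((g ^+ n1)^-1 * (g^-1 * k')); rewrite !insF mulVKg (negPf nHk').
have -> : n2 = (n2 - n1).-1 + 1 + n1 by lia.
by rewrite expgnDr -mulgA mulVKg expgnDr expg1 -mulgA mulVKg skew_mono.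
Qed.

Lemma skew_out g H k : skew g H -> exists n, ~~ ins H ((g ^+ n)^-1 * k).
Proof.
move=> gH; have [gH1 [k' Hk' nHk']] := gH; apply: contrapT => nex.
pose F n := tr (g ^+ n) H.
have insF n x : ins (F n) x = ins H ((g ^+ n)^-1 * x) by rewrite ins_tr.
have [n|n|n1 [n2 [lt E]]] := @separating_finite F (g^-1 * k') k.
- by rewrite insF skew_monoV.
- by rewrite insF; apply: contrapT => /negP ?; apply: nex; exists n.
have := E (g ^+ n1 * k'); rewrite !insF mulKg Hk'.
have -> : n2 = n1 + (1 + (n2 - n1).-1) by lia.
rewrite expgnDr invgM -mulgA mulKg expgnDr invgM -mulgA expg1.
by rewrite (negPf (skew_monoV _ gH nHk')).
Qed.

(** Powers of [g] commute with [c] and push points deep into [H] or its complement, so [H] and [c H]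
    meet, and so do their complements. Being of the same type, their walls do not cross, so the
    halfspaces are nested. *)
Lemma skew_trichotomy g c H : skew g H -> commute c g ->
  [\/ fixes c H, skew c H | skew c^-1 H].
Proof.
move=> gH cg; have [_ [b Hb _]] := gH; pose b' := H.1.
have nHb' : ~~ ins H b' by rewrite ins_base.
have cgn n : commute c^-1 (g ^+ n) by apply/commute_sym/commuteV/commute_sym/commuteX.
have cgn' n : commute c^-1 (g ^+ n)^-1 by apply: commuteV.
have both : exists2 k, ins H k & ins H (c^-1 * k).
  have [n Hn] := skew_in (c * b) gH; exists (g ^+ n * (c * b)) => //.
  by rewrite mulgA cgn -mulgA mulKg; apply: skew_mono.
have none : exists2 k, ~~ ins H k & ~~ ins H (c^-1 * k).
  have [n Hn] := skew_out (c * b') gH; exists ((g ^+ n)^-1 * (c * b')) => //.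
  by rewrite mulgA cgn' -mulgA mulKg; apply: skew_monoV.
have noncross : (forall k, ins H (c^-1 * k) -> ins H k) \/ (forall k, ins H k -> ins H (c^-1 * k)).
  apply: contrapT => /not_orP[/existsNP[k1 /not_implyP[H1 /negP nH1]]].
  case/existsNP=> k2 /not_implyP[H2 /negP nH2].
  have [||||? [_ _]] := @crossing H (tr c H); rewrite ?adj_irrefl //.
  - by case: both => k *; exists k; rewrite ?ins_tr.
  - by exists k2; rewrite ?ins_tr.
  - by exists k1; rewrite ?ins_tr.
  - by case: none => k *; exists k; rewrite ?ins_tr.
case: noncross => cH.
  have [ex|nex] := pselect (exists2 k, ins H k & ~~ ins H (c^-1 * k)).
    by constructor 2.
  constructor 1 => k; apply/idP/idP => [/cH //|Hk].
  by apply: contrapT => /negP ?; apply: nex; exists k.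
have [ex|nex] := pselect (exists2 k, ins H k & ~~ ins H (c^-1^-1 * k)).
  by constructor 3; split=> // k /cH; rewrite invgK mulKg.
constructor 1 => k; apply/idP/idP => [Hk|/cH //].
apply: contrapT => /negP nHk; apply: nex; exists (c^-1 * k) => //.
by rewrite invgK mulVKg.
Qed.

(* Suitable [H_i = g^(-j_i) c^i H] all lie between [g H] and [H], so two of them
   coincide. *)
Lemma skew_power_aux g c H : skew g H -> commute c g -> skew c H ->
  exists p q1 q2, 0 < p /\ fixes (c ^+ p * (g ^+ q1 * (g ^+ q2)^-1)) H.
Proof.
move=> gH cg cH; have [_ [b Hb nHb]] := gH; have nHb' : ~~ ins H H.1 by rewrite ins_base.
have level i : exists j, (forall k, ins H ((c ^+ i)^-1 * (g ^+ j * k)) -> ins H k)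
    /\ (forall k, ins H (g^-1 * k) -> ins H ((c ^+ i)^-1 * (g ^+ j * k))).
  (* [P j] says that [g^-j c^i H] lies in [H]. At the first failure [j.+1], the trichotomy shows
     that the translate contains [H], so [j] is the required level. *)
  pose P j := `[< forall k, ins H ((c ^+ i)^-1 * (g ^+ j * k)) -> ins H k >].
  have exN : exists j, ~~ P j.
    have [n nHn] := skew_out (c ^+ i * b) gH; exists n; apply/asboolPn => Pn.
    by case/negP: nHn; apply: Pn; rewrite mulVKg mulKg.
  case: (ex_minnP exN) => -[|j] nPj minj.
    by case/asboolPn: nPj => k; rewrite expg0 mul1g => /(skew_mono i cH); rewrite mulVKg.
  exists j; split.
    by apply/asboolP; apply: contraT => /minj; rewrite ltnn.
  pose d := (g ^+ j.+1)^-1 * c ^+ i.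
  have dV k : d^-1 * k = (c ^+ i)^-1 * (g ^+ j.+1 * k) by rewrite /d invgM invgK mulgA.
  have dg : commute d g.
    apply/commute_sym/commuteM; last by apply/commuteX/commute_sym.
    by apply/commuteV/commuteX/commute_refl.
  have [dH|[dH _]|[dH _]] := skew_trichotomy gH dg.
  - by case/asboolPn: nPj => k; rewrite -dV dH.
  - by case/asboolPn: nPj => k; rewrite -dV; apply: dH.
  move=> k Hk; have := dH (d^-1 * (g^-1 * k)); rewrite invgK mulVKg => /(_ Hk).
  by rewrite dV expgSr -mulgA mulVKg.
have [f fP] := choice level.
have [n|n|n1 [n2 [lt E]]] :=
  @separating_finite (fun i => tr ((g ^+ f i)^-1 * c ^+ i) H) H.1 (g * b).
- by rewrite ins_tr invgM invgK -mulgA; apply: contra nHb'; apply: (fP n).1.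
- by rewrite ins_tr invgM invgK -mulgA; apply: (fP n).2; rewrite mulKg.
exists (n2 - n1), (f n1), (f n2); split=> [|k]; first by rewrite subn_gt0.
have := E ((g ^+ f n1)^-1 * (c ^+ n1 * k)).
rewrite !ins_tr !invgM !invgK -!mulgA mulVKg mulKg => ->; congr (ins H _).
have cgn i n : commute (c ^+ i)^-1 (g ^+ n) by apply/commute_sym/commuteV/commute_sym/commuteX2.
have E' : c ^+ n2 = c ^+ n1 * c ^+ (n2 - n1) by rewrite -expgnDr subnKC // ltnW.
have /commuteM/(_ (commuteV (cgn n2 (f n1)))) cc := cgn n2 (f n2).
rewrite !mulgA -[(c ^+ n2)^-1 * _ * _]mulgA cc E' invgM.
by rewrite !gnorm.
Qed.

(** The factor [g ^+ q1 * (g ^+ q2)^-1] is an integer power of [g], of either sign. *)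
Lemma skew_power g c H : skew g H -> commute c g ->
  exists p q1 q2, 0 < p /\ fixes (c ^+ p * (g ^+ q1 * (g ^+ q2)^-1)) H.
Proof.
move=> gH cg; have [cH|cH|cH] := skew_trichotomy gH cg.
- by exists 1%N, 0, 0; rewrite expg1 !gnorm.
- exact: skew_power_aux.
have [|p [q1 [q2 [p0 fx]]]] := skew_power_aux gH _ cH.
  by apply/commute_sym/commuteV/commute_sym.
exists p, q2, q1; split=> //; have := fixesV fx; rewrite !invgM expVgn !invgK.
suff -> : c ^+ p * (g ^+ q2 * (g ^+ q1)^-1) = g ^+ q2 * (g ^+ q1)^-1 * c ^+ p by [].
by apply: commuteM; last apply: commuteV; apply: commuteX2.
Qed.

(** The wall and its translate have the same type and cannot cross. Three quadrants are inhabited by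
    points of the line [h * gen l ^+ n], so the fourth is empty, which is the inclusion. *)
Lemma skew_axis K : skew (axis K) K.
Proof.
case: K => h l.
have insK k : ins (h, l) ((axis (h, l))^-1 * k) = hs l ((gen l)^-1 * (h^-1 * k)).
  by rewrite /ins /axis /= !gnorm.
have out : hs l (gen l)^-1 = false.
  rewrite -gen_inv -[gen _]mul1g hs_step hs1 /cross inv_letter_neq eqxx mul1g /=.
  by apply/asboolPn => /(@gen_notin_link (inv_letter l)).
have in2 : hs l (gen l * gen l).
  rewrite hs_step hs_gen /cross eqxx [l == _]eq_sym inv_letter_neq orbF /=.
  by apply/negP => /asboolP; apply: gen_notin_link.
split; last first.
  exists (h * gen l); first exact: (@ins_end (h, l)).
  by rewrite insK mulKg mulVg hs1.
move=> k kH; apply: contrapT => /negP nHk.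
have [||||? [_ _]] := @crossing (h, l) (tr (axis (h, l)) (h, l)); rewrite ?adj_irrefl //.
- exists (h * gen l * gen l); first by rewrite /ins /= -mulgA mulKg.
  by rewrite ins_tr insK -mulgA !mulKg hs_gen.
- exists (h * gen l); first exact: (@ins_end (h, l)).
  by rewrite ins_tr insK mulKg mulVg hs1.
- by exists k; rewrite ?ins_tr.
- exists h; first by rewrite (@ins_base (h, l)).
  by rewrite ins_tr insK mulVg mulg1 out.
Qed.

Lemma axisX K n : axis K ^+ n = K.1 * gen K.2 ^+ n * K.1^-1.
Proof.
elim: n => [|n IHn]; first by rewrite !expg0 !gnorm.
by rewrite !expgS IHn /axis !gnorm.
Qed.

Lemma ev_nseq l n : ev (nseq n l) = gen l ^+ n.
Proof. by elim: n => //= n IHn; rewrite ev_cons IHn expgS. Qed.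

(** The line through [K.1] with all labels [K.2] starts outside [H] and ends inside it; the
    conclusion is read off from the edge where it enters. *)
Lemma skew_axis_inv H K : skew (axis K) H ->
  K.2 = H.2 /\ exists2 t, gen_by (pred1 K.2.1) t & gen_by (adj H.2.1) (H.1^-1 * (K.1 * t)).
Proof.
move=> zH; have [n1 Hn1] := skew_in K.1 zH; have [n2 Hn2] := skew_out K.1 zH.
have [||w1 [m [w2 [E nH Hm]]]] :=
  @path_enter (ins H) ((axis K ^+ n2)^-1 * K.1) (nseq (n2 + n1) K.2) => //.
  suff -> : (axis K ^+ n2)^-1 * K.1 * ev (nseq (n2 + n1) K.2) = axis K ^+ n1 * K.1 by [].
  by rewrite ev_nseq expgnDr !axisX !gnorm.
have [mH lH] := ins_enter nH Hm.
have := all_pred1_nseq K.2 (n2 + n1); rewrite E all_cat /= => /and3P[w1K /eqP mK _].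
split; first by rewrite -mK.
have lK : gen_by (pred1 K.2.1) (gen K.2) by apply: gen_by_gen => /=.
exists ((gen K.2 ^+ n2)^-1 * ev w1).
  apply: gen_byM; first by apply/gen_byV/gen_byX.
  by exists w1 => //; apply: sub_all w1K => l /eqP-> /=.
by move: lH; rewrite axisX !gnorm.
Qed.

Lemma conj_eq h g x : commute (h^-1 * g) x -> h * x * h^-1 = g * x * g^-1.
Proof.
move=> E; apply: (mulIg g); apply: (mulgI h^-1).
by move: E; rewrite /commute -!mulgA !mulKg mulVg mulg1.
Qed.

Lemma skew_axis_eq H K : skew (axis K) H -> axis H = axis K.
Proof.
case/skew_axis_inv=> E [t Kt lt]; rewrite /axis -E.
have tK : commute t (gen K.2).
  by apply: gen_by_comm Kt => l /eqP; apply: gen_comm_same.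
have := link_comm lt; rewrite -E => /conj_eq ->.
by apply/esym/conj_eq; rewrite mulKg.
Qed.

(** The edges labelled [a] at [c] and at [1] have the same axis, so the line through [1] crosses the
    wall at [c]; this writes [c] as a power of the generator times a link element. *)
Lemma centralizer_gen a c : commute c (gen (a, false)) -> gen_by (star a) c.
Proof.
move=> ca; have E : axis (c, (a, false)) = axis (1, (a, false)).
  by rewrite /axis /= ca !gnorm.
have := skew_axis (c, (a, false)); rewrite E => /skew_axis_inv[_ /= [t at_ lt]].
have sub (P Q : pred G) g : (forall b, P b -> Q b) -> gen_by P g -> gen_by Q g.
  by move=> PQ [w Pw ->]; exists w => //; apply: sub_all Pw => l; apply: PQ.
have -> : c = t * (c^-1 * (1 * t))^-1 by rewrite !gnorm.
apply: gen_byM; first by apply: sub at_ => b /=; rewrite /star => ->.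
by apply: gen_byV; apply: sub lt => b /=; rewrite /star => ->; rewrite orbT.
Qed.

Lemma axis_sign H : axis H = H.1 * gen (H.2.1, false) * H.1^-1 \/
  axis H = (H.1 * gen (H.2.1, false) * H.1^-1)^-1.
Proof.
case: H => h [a []]; [right | left] => //.
by rewrite /axis /= -[(a, true)]/(inv_letter (a, false)) gen_inv !gnorm.
Qed.

(** The vertex of the extension graph attached to a wall; unlike [axis H], it does not depend on the
    orientation of the edge. *)
Definition vtx H : T := H.1 * gen (H.2.1, false) * H.1^-1.

Lemma commute_vtx z H : commute z (vtx H) <-> commute z (axis H).
Proof.
have [->//|->] := axis_sign H; split; first exact: commuteV.
by move/commuteV; rewrite invgK.
Qed.

Definition ext_adj (x y : T) : Prop := exists g a b,
  [/\ adj a b, x = g * gen (a, false) * g^-1 & y = g * gen (b, false) * g^-1].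

Lemma vtx_eq H g : gen_by (adj H.2.1) (H.1^-1 * g) ->
  vtx H = g * gen (H.2.1, false) * g^-1.
Proof.
by move/(@link_comm (H.2.1, false))/conj_eq.
Qed.

(** Powers of [c] bring any point into [K] or out of it without changing its side of [H], so all
    four quadrants are nonempty. *)
Lemma fixes_skew_crossing c H K : fixes c H -> skew c K ->
  adj H.2.1 K.2.1 /\ ext_adj (vtx H) (vtx K).
Proof.
move=> cH cK; have cHn n k : ins H (c ^+ n * k) = ins H k.
  by rewrite -[c ^+ n]invgK (fixesV (fixesX n cH)).
have cHn' n k : ins H ((c ^+ n)^-1 * k) = ins H k by rewrite (fixesX n cH).
have E := ins_end H; have B := ins_base H.
have [||||g [lH lK HK]] := @crossing H K.
- by have [n Kn] := skew_in (H.1 * gen H.2) cK; eexists; last exact: Kn; rewrite cHn.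
- by have [n Kn] := skew_out (H.1 * gen H.2) cK; eexists; last exact: Kn; rewrite cHn'.
- by have [n Kn] := skew_in H.1 cK; eexists; last exact: Kn; rewrite cHn B.
- by have [n Kn] := skew_out H.1 cK; eexists; last exact: Kn; rewrite cHn' B.
by split=> //; exists g, H.2.1, K.2.1; rewrite (vtx_eq lH) (vtx_eq lK).
Qed.

(** * Cyclic reduction and the walls skewed by an element *)

Lemma shorten l w : ~~ hs l (ev (l :: w)) ->
  exists2 w', size w' < size (l :: w) & ev w' = ev (l :: w).
Proof.
rewrite ev_cons => out.
have [||u [m [v [-> /negPn Hu nHum]]]] := @path_enter (fun g => ~~ hs l g) (gen l) w.
- by rewrite negbK hs_gen.
- by [].
(* The word leaves the halfspace by the inverse of its first letter; the part [u] in between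
   commutes with [gen l], so both letters can be deleted. *)
have [-> ls] := hs_leave Hu nHum; have := link_comm ls.
rewrite gen_inv /commute mulgVK -mulgA => /mulgI E.
exists (u ++ v); first by rewrite /= !size_cat ltnS leq_add2l /= leqnSn.
by rewrite !ev_cat ev_cons gen_inv {1}E !gnorm.
Qed.

(** By minimality [c] lies beyond the wall of [l] and [c^-1] does not: otherwise a later letter
    would cancel the first one, if need be after conjugation. This fills three quadrants of the wall
    and its translate, so the fourth is empty. *)
Lemma min_skew l w :
  (forall r v, ev (l :: w) = r * ev v * r^-1 -> size w < size v) ->
  skew (ev (l :: w)) (1, l).
Proof.
move=> minw; set c := ev (l :: w).
have Hc : hs l c.
  apply: contraT => /shorten[v vw E]; have := minw 1 v.
  by rewrite E !gnorm => /(_ erefl); move: vw => /=; lia.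
have Hcl : hs l (c * gen l).
  apply: contraT => /(hs_leave Hc)[/esym/eqP].
  by rewrite inv_letter_neq.
have HcV : ~~ hs l c^-1.
  apply/negP => HcV.
  have [||u [m [v [E /negPn Hu nHum]]]] := @path_enter (fun g => ~~ hs l g) c^-1 (l :: w).
  - by rewrite negbK.
  - by rewrite mulVg hs1.
  have [ml ls] := hs_leave Hu nHum.
  case: u E Hu nHum ls => [[/esym/eqP]|l' u [<- E] _ _ ls]; first by rewrite ml inv_letter_neq.
  have lv : gen_by (adj l.1) (ev v).
    have cE : c = ev (l :: u) * gen m * ev v.
      by rewrite /c E !ev_cons ev_cat ev_cons !mulgA.
    have -> : ev v = (c^-1 * ev (l :: u) * gen m)^-1 by rewrite cE !gnorm.
    exact: gen_byV.
  have /minw : c = gen l * ev (u ++ v) * (gen l)^-1.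
    rewrite /c E ev_cons !ev_cat ev_cons ml gen_inv -(commuteV (link_comm lv)).
    by rewrite !gnorm.
  by rewrite E !size_cat /=; lia.
have insc k : ins (1, l) k = hs l k by rewrite /ins /= invg1 mul1g.
split; last first.
  by exists c; rewrite insc // mulVg hs1.
move=> k kc; apply: contrapT => /negP nk.
have [||||? [_ _]] := @crossing (1, l) (tr c (1, l)); rewrite ?adj_irrefl //.
- by exists (c * gen l); rewrite ?ins_tr insc // mulKg hs_gen.
- by exists c; rewrite ?ins_tr insc // mulVg hs1.
- by exists k; rewrite ?ins_tr.
- by exists 1; rewrite ?ins_tr insc ?mulg1 ?hs1.
Qed.

Lemma skew_conj q c l : skew c (1, l) -> skew (q * c * q^-1) (q, l).
Proof.
have E k : ins (q, l) k = ins (1, l) (q^-1 * k) by rewrite /ins /= invg1 mul1g.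
case=> c1 [k Hk nHk]; split=> [k'|].
  by rewrite !E !invgM invgK !mulgA mulVg mul1g -mulgA; apply: c1.
exists (q * k); rewrite E ?mulKg // !invgM invgK !mulgA mulVg mul1g.
by rewrite -!mulgA mulKg.
Qed.

(** A shortest word in a conjugacy class stays shortest under cyclic rotation, so any of its letters
    can be taken as the first. *)
Lemma cyclic_reduction g : exists p w, g = p * ev w * p^-1 /\
  forall w1 l w2, w = w1 ++ l :: w2 -> skew g (p * ev w1, l).
Proof.
have exn : exists n, `[< exists p w, g = p * ev w * p^-1 /\ size w = n >].
  have [w ->] := ev_surj g; exists (size w); apply/asboolP; exists 1, w.
  by rewrite !gnorm.
case: (ex_minnP exn) => _ /asboolP[p [w [gE <-]]] minw; exists p, w; split=> // w1 l w2 E.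
have {}gE : g = (p * ev w1) * ev (l :: w2 ++ w1) * (p * ev w1)^-1.
  by rewrite gE E !ev_cons !ev_cat ev_cons !gnorm.
rewrite {1}gE; apply/skew_conj/min_skew => r v rv.
suff : size w <= size v by rewrite E !size_cat /=; lia.
apply: minw; apply/asboolP; exists (p * ev w1 * r), v; split=> //.
by rewrite gE rv !gnorm.
Qed.

Lemma skew_ex g : g <> 1 -> exists H, skew g H.
Proof.
have [p [[|l w] [-> gw]]] := cyclic_reduction g; first by rewrite ev_nil !gnorm.
by exists (p * ev [::], l); apply: gw.
Qed.

(** The list collects the vertices of the walls along the reduced word; [g] is a product of their
    axes. *)
Lemma skew_support g : exists s : seq T,
  (forall x, x \in s -> exists2 H, skew g H & x = vtx H) /\
  forall z, (forall x, x \in s -> commute z x) -> commute z g.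
Proof.
have [p [w [-> gw]]] := cyclic_reduction g; move: gw; set g' := p * _ * _ => gw.
suff pre w1 w2 : w = w1 ++ w2 -> exists s : seq T,
    (forall x, x \in s -> exists2 H, skew g' H & x = vtx H) /\
    forall z, (forall x, x \in s -> commute z x) -> commute z (p * ev w1 * p^-1).
  by apply: (pre w [::]); rewrite cats0.
elim/last_ind: w1 w2 => [|w1 l IHw] w2 E.
  by exists [::]; split=> // z _; rewrite ev_nil !gnorm; apply: commute1.
rewrite cat_rcons in E; have [s [s1 s2]] := IHw _ E.
exists (vtx (p * ev w1, l) :: s); split=> [x|z zs].
  by rewrite inE => /predU1P[->|/s1//]; exists (p * ev w1, l) => //; apply: gw E.
have -> : p * ev (rcons w1 l) * p^-1 = axis (p * ev w1, l) * (p * ev w1 * p^-1).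
  by rewrite /axis ev_rcons !gnorm.
apply: commuteM; first by apply/commute_vtx/zs; rewrite mem_head.
by apply: s2 => x xs; apply: zs; rewrite inE xs orbT.
Qed.

(** * Commuting elements over a triangle-free graph *)

Lemma commg_central (x y z t : T) : commute z x -> commute z y -> commute t x ->
  commute t y -> commute z t -> [~ x * z, y * t] = [~ x, y].
Proof.
have commE (u v : T) : [~ u, v] = (v * u)^-1 * (u * v) by rewrite /commg /conjg !gnorm.
move=> zx zy tx ty zt; rewrite !commE.
have -> : x * z * (y * t) = x * y * (z * t) by rewrite -mulgA [z * (_ * _)]mulgA zy !mulgA.
have -> : y * t * (x * z) = y * x * (z * t) by rewrite -mulgA [t * (_ * _)]mulgA tx zt !mulgA.
have zty : commute (z * t) (x * y).
  by apply: commute_sym; apply: commuteM; apply/commute_sym/commuteM; apply/commute_sym.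
have ztx : commute (z * t) (y * x).
  by apply: commute_sym; apply: commuteM; apply/commute_sym/commuteM; apply/commute_sym.
by rewrite -zty -ztx !gnorm.
Qed.

Lemma fixes_commg c d H : fixes c H -> fixes d H -> fixes [~ c, d] H.
Proof.
move=> cH dH; rewrite /commg /conjg.
by apply: fixesM; [|apply: fixesM; [|exact: fixesM]]; apply: fixesV.
Qed.

Definition moves g H := skew g H \/ skew g^-1 H.

Lemma moves_power g c H : moves g H -> commute c g ->
  exists p q1 q2, 0 < p /\ fixes (c ^+ p * (g ^+ q1 * (g ^+ q2)^-1)) H.
Proof.
case=> gH cg; first exact: skew_power.
have [p [q1 [q2 [p0 fx]]]] := skew_power gH (commuteV cg).
exists p, q2, q1; split=> //; move: fx; rewrite !expVgn invgK.
suff -> : (g ^+ q1)^-1 * g ^+ q2 = g ^+ q2 * (g ^+ q1)^-1 by [].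
by apply/commute_sym/commuteV/commuteX2/commute_refl.
Qed.

Definition triangleless := forall a b c, adj a b -> adj b c -> ~~ adj a c.

(* Commutators of elements of the centralizer of [g] fix both [H] and [K]; their
   own walls would complete a triangle. *)
Lemma rank_two (g e w : T) H K : triangleless ->
  moves g H -> moves g K -> adj H.2.1 K.2.1 -> commute e g -> commute w g ->
  (forall p q, 0 < p -> 0 < q -> ~ commute (e ^+ p) (w ^+ q)) -> False.
Proof.
move=> tf gH gK HK eg wg ew.
pose gp q1 q2 := g ^+ q1 * (g ^+ q2)^-1.
have gpc x q1 q2 : commute x g -> commute x (gp q1 q2).
  by move=> xg; apply: commuteM; last apply: commuteV; apply: commuteX.
have gpg q1 q2 : commute (gp q1 q2) g by apply/commute_sym/gpc/commute_refl.
have mix x p q1 q2 : commute x g -> commute (x ^+ p * gp q1 q2) g.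
  by move=> xg; apply/commute_sym/commuteM; [apply/commuteX|]; apply/commute_sym.
have central x p q1 q2 n : commute x g ->
    exists2 z, commute z g /\ (forall y, commute y g -> commute y z) &
    (x ^+ p * gp q1 q2) ^+ n = x ^+ (p * n) * z.
  move=> xg; exists (gp q1 q2 ^+ n); first split.
  - by apply/commute_sym/commuteX/commute_sym.
  - by move=> y yg; apply/commuteX/gpc.
  by rewrite expgMn ?expgnA //; apply/gpc/commute_sym/commuteX/commute_sym.
have [p1 [q1 [q1' [p1_gt0 eH]]]] := moves_power gH eg.
have [p2 [q2 [q2' [p2_gt0 wH]]]] := moves_power gH wg.
set e1 := e ^+ p1 * _ in eH; set w1 := w ^+ p2 * _ in wH.
have e1g : commute e1 g by apply: mix.
have w1g : commute w1 g by apply: mix.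
have [p3 [q3 [q3' [p3_gt0 eK]]]] := moves_power gK e1g.
have [p4 [q4 [q4' [p4_gt0 wK]]]] := moves_power gK w1g.
have XG x n : commute x g -> commute (x ^+ n) g.
  by move=> xg; apply/commute_sym/commuteX/commute_sym.
(* The corrections by powers of [g] do not change the commutator, so one commutator fixes both [H]
   and [K]. *)
have cE : [~ e1 ^+ p3 * gp q3 q3', w1 ^+ p4 * gp q4 q4'] = [~ e1 ^+ p3, w1 ^+ p4].
  by apply: commg_central; do ?[apply: gpc | apply/commute_sym/gpc]; rewrite ?gpg //; apply: XG.
have cH : fixes [~ e1 ^+ p3, w1 ^+ p4] H by apply: fixes_commg; apply: fixesX.
have cK : fixes [~ e1 ^+ p3, w1 ^+ p4] K by rewrite -cE; apply: fixes_commg.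
have [M cM] : exists M, skew [~ e1 ^+ p3, w1 ^+ p4] M.
  apply: skew_ex => /eqP/commgP; have p13 : 0 < p1 * p3 by rewrite muln_gt0 p1_gt0.
  have p24 : 0 < p2 * p4 by rewrite muln_gt0 p2_gt0.
  have [z [zg zc] ->] := central e p1 q1 q1' p3 eg.
  have [t [tg tc] ->] := central w p2 q2 q2' p4 wg.
  move/commgP/eqP; rewrite commg_central; last by apply: tc.
  - by move/eqP/commgP; apply: ew.
  - by apply/commute_sym/zc/XG.
  - by apply/commute_sym/zc/XG.
  - by apply/commute_sym/tc/XG.
  - by apply/commute_sym/tc/XG.
have [HM _] := fixes_skew_crossing cH cM; have [KM _] := fixes_skew_crossing cK cM.
by have := tf _ _ _ HK KM; rewrite HM.
Qed.

(** Here [f], [w], [h], [e] are images of consecutive vertices of a cycle. If [h] moved [H], some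
    nontrivial [k = h^p w^(q1-q2)] would fix [H] and skew a wall [K] crossing it. If [h] or [w]
    moves [K], [rank_two] applies around that element; if both fix [K], so does [k]. *)
Lemma neighbour_fixes (w h e f : T) H : triangleless ->
  commute h w -> commute e h -> commute f w ->
  (forall p q, 0 < p -> 0 < q -> ~ commute (e ^+ p) (w ^+ q)) ->
  (forall p q, 0 < p -> 0 < q -> ~ commute (f ^+ p) (h ^+ q)) ->
  (forall p q1 q2, 0 < p -> h ^+ p * (w ^+ q1 * (w ^+ q2)^-1) <> 1) ->
  skew w H -> fixes h H.
Proof.
move=> tf hw eh fw ew fh hpw wH.
suff nmoves : ~ moves h H.
  by have [//|hH|hH] := skew_trichotomy wH hw; case: nmoves; [left | right].
move=> hH; have [p [q1 [q2 [p0 kH]]]] := skew_power wH hw.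
have [K kK] := skew_ex (hpw p q1 q2 p0); have [HK _] := fixes_skew_crossing kH kK.
move: kH kK; set k := _ * _ => kH kK.
have kcomm x : commute x h -> commute x w -> commute x k.
  by move=> xh xw; apply: commuteM; [|apply: commuteM; last apply: commuteV]; apply: commuteX.
have fixes_or_moves x : commute x k -> fixes x K \/ moves x K.
  by move=> xk; have [?|?|?] := skew_trichotomy kK xk; [left | right; left | right; right].
have [hK|hK] := fixes_or_moves h (kcomm h (commute_refl h) hw); last first.
  exact: (rank_two tf hH hK HK eh (commute_sym hw)).
have [wK|wK] := fixes_or_moves w (kcomm w (commute_sym hw) (commute_refl w)); last first.
  by apply: (rank_two tf _ wK HK fw hw fh); left.
case: (skew_not_fixes kK); apply: fixesM; first exact: fixesX.
by apply: fixesM; last apply: fixesV; apply: fixesX.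
Qed.

(** Correcting [g2] and then [g3] by powers of the earlier elements yields three pairwise crossing
    walls, whose types form a triangle. *)
Lemma no_rank_three (g1 g2 g3 : T) : triangleless -> 
  commute g2 g1 -> commute g3 g1 -> commute g3 g2 -> g1 <> 1 ->
  (forall p q1 q2, 0 < p -> g2 ^+ p * (g1 ^+ q1 * (g1 ^+ q2)^-1) <> 1) ->
  (forall p q1 q2 p' q1' q2' p'' q1'' q2'', 0 < p -> 0 < p' ->
     let k2 := g2 ^+ p'' * (g1 ^+ q1'' * (g1 ^+ q2'')^-1) in
     (g3 ^+ p * (g1 ^+ q1 * (g1 ^+ q2)^-1)) ^+ p' * (k2 ^+ q1' * (k2 ^+ q2')^-1) <> 1) ->
  False.
Proof.
move=> tf c21 c31 c32 /skew_ex[H gH] ind2 ind3.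
have [p [q1 [q2 [p0 fx2]]]] := skew_power gH c21.
have [p' [q1' [q2' [p0' fx3]]]] := skew_power gH c31.
have [K kK] := skew_ex (ind2 p q1 q2 p0); have [HK _] := fixes_skew_crossing fx2 kK.
move: fx2 fx3 kK; set k2 := _ * _ => fx2; set k3 := _ * _ => fx3 kK.
have k32 : commute k3 k2.
  have gk x : commute x g1 -> commute x g2 -> commute x k2.
    by move=> x1 x2; apply: commuteM; [|apply: commuteM; last apply: commuteV]; apply: commuteX.
  have k1 := gk _ (commute_refl g1) (commute_sym c21).
  by apply/commute_sym/commuteM; [|apply: commuteM; last apply: commuteV]; apply: commuteX; 
    apply: commute_sym => //; apply: gk.
have [r [s1 [s2 [r0 fxK]]]] := skew_power kK k32.
have [M cM] := skew_ex (ind3 p' q1' q2' r s1 s2 p q1 q2 p0' r0).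
have [KM _] := fixes_skew_crossing fxK cM.
have [|HM _] := fixes_skew_crossing (H := H) _ cM.
  by apply: fixesM; [|apply: fixesM; last apply: fixesV]; apply: fixesX.
by have := tf _ _ _ HK KM; rewrite HM.
Qed.

(** Otherwise a positive power of the generator [b] times a power of the generator [a] would fix the
    wall of [a] and lie in the link subgroup of [a], where the exponent of [b] vanishes. *)
Lemma gen_power_noncommuting a b p q : a != b -> ~~ adj a b -> 0 < p -> 0 < q ->
  ~ commute (gen (a, false) ^+ p) (gen (b, false) ^+ q).
Proof.
move=> ab_ nadj p0 q0 E.
have H0 : skew (gen (a, false)) (1, (a, false)).
  by have := skew_axis (1, (a, false)); rewrite /axis /= !gnorm.
have [r [q1 [q2 [r0]]]] := skew_power (skewX p0 H0) (commute_sym E).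
move=> /fixes_link /=; rewrite !gnorm => /(@ab_gen_by _ b)/(_ nadj).
rewrite !(abM, abV, abX, ab_gen) /= eqxx (negPf ab_) => /eqP.
lia.
Qed.

(** * The extension graph *)

(** The elements [g] with this property form a coset of the star subgroup of the type of [x]; it
    locates [x] in the Cayley graph. *)
Definition rep (x g : T) : Prop := exists a, x = g * gen (a, false) * g^-1.

Lemma ab_conj a b g : ab b (g * gen (a, false) * g^-1) = Posz (a == b).
Proof. by rewrite !abM abV ab_gen /=; case: eqP; lia. Qed.

Lemma conj_gen_inj a b g h :
  g * gen (a, false) * g^-1 = h * gen (b, false) * h^-1 -> a = b.
Proof. by move/(congr1 (ab b)); rewrite !ab_conj eqxx; case: eqP. Qed.

Lemma ext_adj_sym x y : ext_adj x y -> ext_adj y x.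
Proof. by case=> g [a [b [ab_ -> ->]]]; exists g, b, a; rewrite adj_sym. Qed.

Lemma ext_adj_conj u x y : ext_adj x y -> ext_adj (u^-1 * x * u) (u^-1 * y * u).
Proof.
by case=> g [a [b [ab_ -> ->]]]; exists (u^-1 * g), a, b; rewrite !gnorm.
Qed.

Lemma ext_adj_comm x y : ext_adj x y -> commute x y.
Proof.
case=> g [a [b [/(@gen_comm (a, false) (b, false)) E -> ->]]].
by rewrite /commute !gnorm -[g * _ * gen (b, false)]mulgA E !gnorm.
Qed.

Lemma ext_adj_rep x y : ext_adj x y -> exists2 g, rep x g & rep y g.
Proof. by case=> g [a [b [_ -> ->]]]; exists g; [exists a | exists b]. Qed.

Lemma ext_triangleless x y z :
  triangleless -> ext_adj x y -> ext_adj y z -> ~ ext_adj x z.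
Proof.
move=> tf [g [a [b [ab_ -> ->]]]] [h [b' [c [bc /conj_gen_inj E ->]]]].
case=> k [a' [c' [ac /conj_gen_inj E1 /conj_gen_inj E2]]]; subst b' a' c'.
by have := tf _ _ _ ab_ bc; rewrite ac.
Qed.

(** By the trichotomy [x] fixes the wall of [y], which gives a crossing, or skews it, which gives
    equal axes; backward skewing would force exponent sums of opposite signs. *)
Lemma ext_adj_of_comm x y g h :
  rep x g -> rep y h -> commute x y -> x = y \/ ext_adj x y.
Proof.
case=> a xE [b yE]; pose K := (g, (a, false)); pose H := (h, (b, false)).
have xK : x = axis K by []; have yH : y = axis H by [].
rewrite xK yH => xy; have [fx|/skew_axis_eq|] := skew_trichotomy (skew_axis H) xy.
- by right; apply/ext_adj_sym; have [_] := fixes_skew_crossing fx (skew_axis K).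
- by left.
have E : (axis K)^-1 = axis (opp K) by rewrite /axis /opp /= gen_inv !gnorm.
rewrite E => /skew_axis_eq; rewrite -E => /(congr1 (ab b)).
by rewrite abV -xK -yH xE yE !ab_conj eqxx; case: eqP; lia.
Qed.

Lemma rep_comm x g c : rep x g -> commute c x -> rep x (c * g).
Proof.
by case=> a xE cx; exists a; rewrite -[LHS](mulgK c) -cx xE !gnorm.
Qed.

Lemma star_comm a c : gen_by (star a) c -> commute c (gen (a, false)).
Proof.
apply: gen_by_comm => l /orP[/eqP la|al]; first exact: gen_comm_same.
by apply: gen_comm; rewrite adj_sym.
Qed.

Lemma conj_star a g c : gen_by (star a) c ->
  g * gen (a, false) * g^-1 = (g * c) * gen (a, false) * (g * c)^-1.
Proof. by move=> ac; apply: conj_eq; rewrite mulKg; apply: star_comm. Qed.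

(** * Folding along a wall *)

Definition beyond u x : Prop := forall g, rep x g -> hs u g.

Lemma beyond_ncomm u x g : rep x g -> beyond u x -> ~ commute (gen u) x.
Proof.
move=> xg ux cux; have ugen : skew (gen u) (1, u).
  by have := skew_axis (1, u); rewrite /axis /= !gnorm.
have [n] := skew_out g ugen; rewrite /ins /= invg1 mul1g => /negP; apply.
apply/ux/rep_comm => //; apply/commute_sym/commuteV/commuteX.
exact: commute_sym.
Qed.

(* [rep x] is connected, and an edge of it across the wall of [u] is an edge
   whose label lies in the star of the type of [x]. *)
Lemma not_beyond_comm u x g : rep x g -> hs u g -> ~ beyond u x -> commute (gen u) x.
Proof.
case=> a xE ug /existsNP[g' /not_implyP[[b xE'] /negP ug']].
have ? : a = b by apply: (@conj_gen_inj _ _ g g'); rewrite -xE -xE'.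
subst b; have : commute (g^-1 * g') (gen (a, false)).
  apply: (mulgI g); apply: (mulIg g'^-1); rewrite !gnorm.
  by move: xE'; rewrite xE => ->.
case/centralizer_gen=> w aw E.
have [||w1 [m [w2 [Ew /negPn H1 H2]]]] := @path_enter (fun k => ~~ hs u k) g w.
- by rewrite negbK.
- by rewrite -E mulVKg.
have [mu lu] := hs_leave H1 H2; move: aw; rewrite Ew all_cat /= => /and3P[aw1 am _].
have ac : gen_by (star a) (ev w1 * gen m).
  by apply: gen_byM; [exists w1 | apply: gen_by_gen].
rewrite xE (conj_star g ac) mulgA; have up := commute_sym (link_comm lu).
apply: commuteM; last exact: commuteV.
apply: commuteM => //; apply/star_comm/gen_by_gen.
by rewrite mu in am.
Qed.

Lemma beyond_ext_adj u x y : ext_adj x y -> beyond u x -> ~ beyond u y -> commute (gen u) y.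
Proof. by case/ext_adj_rep=> g xg yg ux; apply: not_beyond_comm yg (ux _ xg). Qed.

(** The far side of the wall is translated back by [gen u]. Vertices whose coset meets both sides
    commute with [gen u], so the two rules agree on them; this is why adjacency survives. *)
Definition fold u x : T := if `[< beyond u x >] then (gen u)^-1 * x * gen u else x.

Lemma foldT u x : beyond u x -> fold u x = (gen u)^-1 * x * gen u.
Proof. by move=> ux; rewrite /fold asboolT. Qed.

Lemma foldF u x : ~ beyond u x -> fold u x = x.
Proof. by move=> ux; rewrite /fold asboolF. Qed.

Lemma fold_comm u x : commute (gen u) x -> fold u x = x.
Proof. by move=> ux; rewrite /fold; case: ifP => // _; rewrite -mulgA -ux mulKg. Qed.

Lemma fold_ext_adj u x y : ext_adj x y -> ext_adj (fold u x) (fold u y).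
Proof.
move=> xy; have yx := ext_adj_sym xy.
have conj_comm z : commute (gen u) z -> (gen u)^-1 * z * gen u = z.
  by move=> uz; rewrite -mulgA -uz mulKg.
have [ux|nux] := pselect (beyond u x); have [uy|nuy] := pselect (beyond u y).
- by rewrite !foldT //; apply: ext_adj_conj.
- have uy := beyond_ext_adj xy ux nuy.
  by rewrite foldT // foldF // -(conj_comm y uy); apply: ext_adj_conj.
- have ux := beyond_ext_adj yx uy nux.
  by rewrite foldF // foldT // -(conj_comm x ux); apply: ext_adj_conj.
- by rewrite !foldF.
Qed.

Lemma rep_fold u x g : rep x g -> rep (fold u x) (if `[< beyond u x >] then (gen u)^-1 * g else g).
Proof.
by case=> a xE; rewrite /fold; case: ifP => _; exists a; rewrite xE ?gnorm.
Qed.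

Definition rep_size x n := `[< exists w, size w = n /\ rep x (ev w) >].

(** The length of a shortest representative; [0] is also the default for elements that are not
    conjugates of generators. *)
Definition len x : nat :=
  if pselect (exists n, rep_size x n) is left ex then ex_minn ex else 0.

Lemma lenP x g : rep x g -> exists2 w, size w = len x & rep x (ev w).
Proof.
move=> xg; rewrite /len; case: pselect => [ex|[]].
  by case: ex_minnP => n /asboolP[w [? ?]] _; exists w.
by have [w E] := ev_surj g; exists (size w); apply/asboolP; exists w; rewrite -E.
Qed.

Lemma len_min x w : rep x (ev w) -> len x <= size w.
Proof.
move=> xw; rewrite /len; case: pselect => // ex.
by case: ex_minnP => n _; apply; apply/asboolP; exists w.
Qed.

Lemma len_beyond u x g : rep x g -> beyond u x -> len (fold u x) < len x.
Proof.
case/lenP=> w wl xw ux.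
have [||w1 [m [w2 [E H1 H2]]]] := @path_enter (hs u) 1 w; rewrite ?hs1 ?mul1g //.
  exact: ux.
rewrite mul1g in H1 H2; have [mu lu] := hs_enter H1 H2; subst m.
(* The letters before the crossing commute with [gen u], so [u] moves to the front, where the fold
   removes it. *)
have Ew : ev w = gen u * ev (w1 ++ w2).
  by rewrite E !ev_cat ev_cons mulgA (link_comm lu) !mulgA.
have /len_min : rep (fold u x) (ev (w1 ++ w2)).
  by have := rep_fold u xw; rewrite asboolT // Ew mulKg.
by rewrite -wl E !size_cat /= addnS ltnS.
Qed.

Lemma len_fold u x g : rep x g -> len (fold u x) <= len x.
Proof.
move=> xg; have [ux|nux] := pselect (beyond u x); last by rewrite foldF.
exact: ltnW (len_beyond xg ux).
Qed.

(** The first letter of a shortest representative works: if its wall did not have all of the coset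
    beyond it, [gen u] would commute with [x] and the letter could be dropped. *)
Lemma beyond_ex x g : rep x g -> 0 < len x -> exists u, beyond u x.
Proof.
case/lenP=> -[|u w] wl xw; first by rewrite -wl.
move=> _; exists u; apply: contrapT => nux.
have hw : hs u (ev (u :: w)).
  apply: contraT => /shorten[v vw E]; have := @len_min x v.
  by rewrite E => /(_ xw); rewrite -wl leqNgt vw.
have ux := not_beyond_comm xw hw nux.
have := rep_comm xw (commute_sym (commuteV (commute_sym ux))).
by rewrite ev_cons mulKg => /len_min; rewrite -wl ltnn.
Qed.

Lemma len0 x g : rep x g -> len x = 0 -> exists a, x = gen (a, false).
Proof.
case/lenP=> -[|l w] wl xw; last by rewrite -wl.
by case: xw => a -> _; exists a; rewrite ev_nil !gnorm.
Qed.

Lemma len_gen u : len (gen (u, false)) = 0.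
Proof.
apply/eqP; rewrite -leqn0; apply: (@len_min _ [::]); exists u.
by rewrite ev_nil !gnorm.
Qed.

End Walls.

(** * Holes *)

Lemma sum_shift (F : nat -> nat) n r : (forall i, F (i + n)%N = F i) ->
  \sum_(i < n) F (i + r)%N = \sum_(i < n) F i.
Proof.
move=> per; elim: r => [|r IHr]; first by apply: eq_bigr => i _; rewrite addn0.
rewrite -{}IHr; case: n per => [|n] per; first by rewrite !big_ord0.
rewrite big_ord_recr [RHS]big_ord_recl /= addnC add0n.
have -> : F (n + r.+1)%N = F r by rewrite -(per r); congr F; lia.
by congr addn; apply: eq_bigr => i _; congr F; rewrite /bump /=; lia.
Qed.

Lemma sum_prefix (F : nat -> nat) m n : m <= n ->
  \sum_(i < m) F i <= \sum_(i < n) F i.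
Proof.
move=> mn; rewrite -(subnKC mn) big_split_ord /=; exact: leq_addr.
Qed.

Lemma sum_uniq_le (F : nat -> nat) (s : seq nat) n :
  uniq s -> all (fun i => i < n) s -> \sum_(i <- s) F i <= \sum_(i < n) F i.
Proof.
move=> us sn; rewrite -(big_mkord xpredT F) [leqRHS](bigID (mem s)) /=
  -[X in _ <= (X + _)%N]big_filter.
have ps : perm_eq s [seq i <- index_iota 0 n | i \in s].
  apply: uniq_perm => //; first by rewrite filter_uniq // iota_uniq.
  move=> i; rewrite mem_filter mem_index_iota /=.
  by case si: (i \in s) => //=; rewrite (allP sn _ si).
by rewrite -(perm_big _ ps) leq_addr.
Qed.

Section Holes.
Variables (X : Type) (R : X -> X -> Prop).
Hypothesis Rsym : forall x y, R x y -> R y x.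

Definition closed_walk n (f : nat -> X) : Prop :=
  (forall i, f (i + n)%N = f i) /\ forall i, R (f i) (f i.+1).

Definition hole n (f : nat -> X) : Prop :=
  [/\ forall i, f (i + n)%N = f i, forall i, R (f i) (f i.+1)
    & forall i d, 2 <= d -> d.+2 <= n -> ~ R (f i) (f (i + d)%N)].

Lemma hole_shift n f r : hole n f -> hole n (fun i => f (i + r)%N).
Proof.
case=> per con non; split=> [i|i|i d d2 dn].
- by rewrite addnAC per.
- by rewrite addSn.
- by rewrite addnAC; apply: non.
Qed.

Lemma closed_walk_of_prefix n (f : nat -> X) : 0 < n ->
  (forall i, i.+1 < n -> R (f i) (f i.+1)) -> R (f n.-1) (f 0) ->
  closed_walk n (fun i => f (i %% n)).
Proof.
move=> n0 con last; split=> [i|i]; first by rewrite modnDr.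
have := ltn_pmod i n0; rewrite modnS; case: ifP => [dv _|ndv lt].
  suff -> : i %% n = n.-1 by [].
  have E : (i %% n).+1 = n %[mod n].
    by rewrite modnn -addn1 modnDml addn1; apply/eqP.
  have := ltn_pmod i n0; have [small|big] := ltnP (i %% n).+1 n; last by lia.
  by rewrite (modn_small small) modnn in E.
apply: con; rewrite ltn_neqAle lt andbT; apply: contraFneq ndv => E.
by rewrite /dvdn -addn1 -modnDml addn1 E modnn.
Qed.

(** One period is enough to check; the disjunction exempts the closing edge between [0] and
    [n.-1]. *)
Lemma hole_of_prefix n (f : nat -> X) : 0 < n ->
  (forall i, i.+1 < n -> R (f i) (f i.+1)) -> R (f n.-1) (f 0) ->
  (forall i j, i.+2 <= j -> j < n -> 0 < i \/ j.+1 < n -> ~ R (f i) (f j)) ->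
  hole n (fun i => f (i %% n)).
Proof.
move=> n0 con last non; have [per con'] := closed_walk_of_prefix n0 con last.
split=> // i d d2 dn; have lt := ltn_pmod i n0; have lt' := ltn_pmod (i + d) n0.
have := modnDml i d n; have [small|big] := ltnP (i %% n + d) n.
  rewrite modn_small // => <-; apply: non; lia.
rewrite -(subnK big) modnDr modn_small; last by lia.
by move=> <- /Rsym; apply: non; lia.
Qed.

Lemma hole_lt n f i j : hole n f -> i.+2 <= j -> j < n -> 0 < i \/ j.+1 < n ->
  ~ R (f i) (f j).
Proof.
case=> _ _ non ij jn edge; have -> : j = (i + (j - i))%N by lia.
by apply: non; lia.
Qed.

(** If the vertices coincided, the successor of [i + d] would give a chord at [i]; for [d = n - 2]
    its predecessor does, at distance 3 from [i + n]. *)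
Lemma hole_neq n f i d : 5 <= n -> hole n f -> 2 <= d -> d.+2 <= n ->
  f i <> f (i + d)%N.
Proof.
move=> n5 [per con non] d2 dn E; have [d3|d3] := ltnP d.+2 n.
  by apply: (non i d.+1); [lia | lia | rewrite E addnS; apply: con].
apply: (non (i + d.-1)%N 3); [by []|by lia|].
have -> : (i + d.-1 + 3)%N = (i + n)%N by lia.
by rewrite per E -[in X in R _ (f X)](@prednK d) ?addnS //; lia.
Qed.

(** Every chord of a pentagon cuts off a triangle. *)
Lemma hole5 x0 x1 x2 x3 x4 :
  (forall x y z, R x y -> R y z -> ~ R x z) ->
  R x0 x1 -> R x1 x2 -> R x2 x3 -> R x3 x4 -> R x4 x0 ->
  hole 5 (fun i => nth x0 [:: x0; x1; x2; x3; x4] (i %% 5)).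
Proof.
move=> tf r01 r12 r23 r34 r40; apply: hole_of_prefix => //.
  by case=> [|[|[|[|?]]]].
move=> i j ij jn edge; suff : (i, j) \in [:: (0, 2); (0, 3); (1%N, 3); (1%N, 4); (2, 4)].
  rewrite !inE => /or4P[|||/orP[]] /eqP[-> ->] /=; first exact: tf r01 r12.
  - by move/Rsym; apply: tf r34 r40.
  - exact: tf r12 r23.
  - by move/Rsym; apply: tf r40 r01.
  - exact: tf r23 r34.
move: ij jn edge; case: i => [|[|[|i]]]; case: j => [|[|[|[|[|j]]]]] //=; try lia.
Qed.

End Holes.

Section SetHoles.
Variables (X : eqType) (R : X -> X -> Prop).
Hypothesis Rsym : forall x y, R x y -> R y x.
Hypothesis Rtf : forall x y z, R x y -> R y z -> ~ R x z.

Definition complete (A B : seq X) : Prop :=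
  forall x y, x \in A -> y \in B -> R x y.

Lemma complete_sym A B : complete A B -> complete B A.
Proof. by move=> AB x y xB yA; apply/Rsym/AB. Qed.

Lemma completeW A A' B : {subset A' <= A} -> complete A B -> complete A' B.
Proof. by move=> AA AB x y /AA; apply: AB. Qed.

Lemma complete_tf A B C : A != [::] -> B != [::] -> C != [::] ->
  complete A B -> complete B C -> ~ complete A C.
Proof.
case: A B C => [//|a A] [//|b B] [//|c C] _ _ _ AB BC AC.
by apply: (Rtf (AB a b _ _) (BC b c _ _) (AC a c _ _)); rewrite mem_head.
Qed.

(* If [S 0] has at least two elements, some proper part [C] of it is not
   complete to [S 3]; closing up at the first [S k] to which [C] is complete
   gives a smaller family, of length at least 5. *)
Lemma hole_of_complete_hole n (S : nat -> seq X) : 5 <= n ->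
  (forall i, S i != [::]) -> hole complete n S ->
  exists m f, 5 <= m <= n /\ hole R m f.
Proof.
have [N leN] := ubnP (\sum_(i < n) size (S i)).
elim: N n S leN => // N IHN n S leN n5 S0 hS.
have [big|small] := pselect (exists i, 1 < size (S i)); last first.
  have sz i : exists x, S i = [:: x].
    have := S0 i; case E : (S i) => [//|x [|y s]] _; first by exists x.
    by case: small; exists i; rewrite E.
  have [f fE] := choice sz; exists n, f; split; first by rewrite n5 leqnn.
  case: hS => per con non; split=> [i|i|i d d2 dn r].
  - by have := per i; rewrite !fE => -[].
  - by apply: (con i); rewrite fE mem_head.
  - by apply: (non i d) => // x y; rewrite !fE !inE => /eqP-> /eqP->.
case: big => r Sr; have := hole_shift r hS; set S' := fun i => _ => hS'.
have S0' i : S' i != [::] by apply: S0.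
have sumE : \sum_(i < n) size (S' i) = \sum_(i < n) size (S i).
  by apply: (@sum_shift (fun i => size (S i))) => i; case: hS => ->.
have [C [CS0 C0 Csz C3]] : exists C : seq X, [/\ {subset C <= S' 0}, C != [::],
    size C < size (S' 0) & ~ complete C (S' 3)].
  have n03 : ~ complete (S' 0) (S' 3) by case: hS' => _ _ /(_ 0 3); apply.
  have : 1 < size (S' 0) by rewrite /S' add0n.
  case E : (S' 0) n03 => [//|x [//|y s]] n03 _.
  have [c1|] := pselect (complete [:: x] (S' 3)); last first.
    by exists [:: x]; split=> // z; rewrite inE => /eqP->; rewrite mem_head.
  exists (y :: s); split=> // [z zs|c2]; first by rewrite inE zs orbT.
  by apply: n03 => a b; rewrite inE => /predU1P[->|]; [apply: c1; rewrite mem_head | apply: c2].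
case: (hS') => per con non.
pose P k := (1 < k) && `[< complete C (S' k) >].
have Pn : P n.-1.
  apply/andP; split; first by lia.
  apply/asboolP/complete_sym => x y xS /CS0 yS; apply: (con n.-1) => //.
  have -> : n.-1.+1 = (0 + n)%N by lia.
  by rewrite per.
have exP : exists k, P k by exists n.-1.
case: (ex_minnP exP) => k /andP[k1 /asboolP Ck] mink.
have kn : k < n by have := mink _ Pn; lia.
(* [k = 2] would give a triangle and [k = 3] contradicts the choice of [C], so the new length [k.+1]
   is at least 5. *)
have k2 : k != 2.
  apply/eqP => k2; subst k; apply: (complete_tf C0 (S0' 1%N) (S0' 2)) => //.
  exact: completeW (con 0).
have k3 : k != 3 by apply/eqP => k3; subst k.
pose S'' i := if i is 0 then C else S' i.
have [||i||m [f [mk hf]]] := IHN k.+1 (fun i => S'' (i %% k.+1)).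
- have -> : \sum_(i < k.+1) size (S'' (i %% k.+1)) = \sum_(i < k.+1) size (S'' i).
    by apply: eq_bigr => i _; rewrite modn_small.
  apply: (@leq_trans (\sum_(i < n) size (S' i))); last by rewrite sumE -ltnS.
  apply: leq_trans (sum_prefix (fun i => size (S' i)) kn).
  by rewrite !big_ord_recl /= ltn_add2r.
- by lia.
- by rewrite /S''; case: (i %% k.+1) => [|j]; [apply: C0 | apply: S0'].
- apply: hole_of_prefix => //=.
  + exact: complete_sym.
  + case=> [_|i ik]; last exact: con.
    exact: completeW (con 0).
  + case: (k) k1 Ck => // k' _; exact: complete_sym.
  case=> [|i] [|j] //= ij jk edge.
    move/asboolP => Cj; have : k <= j.+1; last by lia.
    by apply: mink; apply/andP.
  by apply: (hole_lt hS'); lia.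
by exists m, f; split=> //; lia.
Qed.

End SetHoles.

(** * Folding *)

(** The arc around [i] runs between the nearest failures of [Q] on both sides. These satisfy [J],
    which fails at [q], so neither is a copy of [q]; this gives [k + 3 <= n]. *)
Lemma periodic_arc (Q J : pred nat) n q i : 0 < n ->
  (forall k, Q (k + n)%N = Q k) -> (forall k, J (k + n)%N = J k) ->
  (forall k, Q k -> ~~ Q k.+1 -> J k.+1) -> (forall k, ~~ Q k -> Q k.+1 -> J k) ->
  ~~ Q q -> ~~ J q -> Q i -> Q i.+1 ->
  exists r k, [/\ 1 < k, k + 3 <= n, J r, J (r + k.+1)%N &
    forall j, 0 < j <= k -> Q (r + j)%N].
Proof.
move=> n_gt0 perQ perJ out into nQq nJq Qi Qi1.
(* [q + s] is the copy of [i] in the period starting at [q]; the term [q * n] keeps the subtraction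
   from truncating. *)
pose s := ((i + q * n - q) %% n)%N; have sn : s < n by apply: ltn_pmod.
have mulQ k d : Q (k + d * n)%N = Q k.
  elim: d => [|d IHd]; first by rewrite mul0n addn0.
  by rewrite mulSn addnA addnAC perQ.
have Qmod k : Q (k %% n)%N = Q k by rewrite [in RHS](divn_eq k n) addnC mulQ.
have leq : q <= i + q * n by rewrite (leq_trans (leq_pmulr q n_gt0)) // leq_addl.
have Qqs : Q (q + s)%N.
  by rewrite -Qmod modnDmr subnKC // Qmod mulQ.
have Qqs1 : Q (q + s).+1.
  by rewrite -addnS -Qmod -addn1 addnA -modnDml modnDmr subnKC // modnDml addnAC Qmod mulQ addn1.
have ex1 : exists r, (q <= r <= q + s) && ~~ Q r by exists q; rewrite leqnn leq_addr.
have ub r : (q <= r <= q + s) && ~~ Q r -> r <= q + s by case/andP=> /andP[].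
case: (ex_maxnP ex1 ub) => r /andP[/andP[qr rs] nQr] maxr.
have ex2 : exists e, (q + s <= e) && ~~ Q e.
  by exists (q + n)%N; rewrite perQ nQq andbT leq_add2l ltnW.
case: (ex_minnP ex2) => e /andP[se nQe] mine.
have eqn : e <= q + n by apply: mine; rewrite perQ nQq andbT leq_add2l ltnW.
have Qin k : r < k -> k < e -> Q k.
  move=> rk ke; apply: contraT => nQk; have [ks|sk] := leqP k (q + s).
    have /maxr : (q <= k <= q + s) && ~~ Q k by rewrite nQk ks; lia.
    by lia.
  have /mine : (q + s <= k) && ~~ Q k by rewrite nQk ltnW.
  by lia.
have rs' : r < q + s by rewrite ltn_neqAle rs andbT; apply: contraNneq nQr => ->.
have se' : (q + s).+1 < e.
  have : e != (q + s)%N by apply: contraNneq nQe => ->.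
  have : e != (q + s).+1 by apply: contraNneq nQe => ->.
  lia.
have Jr : J r by apply: into => //; apply: Qin; lia.
have Je : J e.
  by case: e nQe se' Qin {mine se eqn} => // e nQe se' Qin; apply: out => //; apply: Qin; lia.
have rq : r != q by apply: contraNneq nJq => <-.
have eq' : e != (q + n)%N by apply: contraNneq nJq => E; rewrite -perJ -E.
exists r, (e - r).-1; split; [lia|lia|by []| |].
- by have -> : (r + (e - r).-1.+1)%N = e by lia.
- by move=> j jk; apply: Qin; lia.
Qed.

Section Fold.
Variable G : sgraph.
Local Notation T := (raag G).
Hypothesis tf : triangleless G.

Lemma ext_adjT (x y z : T) : ext_adj x y -> ext_adj y z -> ~ ext_adj x z.
Proof. exact: ext_triangleless. Qed.

(** Conjugating both vertices or neither reflects adjacency, and a vertex commuting with [gen u]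
    counts as either kind; only mixed pairs can become adjacent. *)
Lemma fold_ext_adj_inv u (x y : T) : ext_adj (fold u x) (fold u y) ->
  [\/ ext_adj x y,
      [/\ beyond u x, ~ beyond u y & ~ commute (gen u) y]
    | [/\ beyond u y, ~ beyond u x & ~ commute (gen u) x]].
Proof.
have conjK (x' y' : T) : ext_adj ((gen u)^-1 * x' * gen u) ((gen u)^-1 * y' * gen u) ->
    ext_adj x' y'.
  by move/(ext_adj_conj (gen u)^-1); rewrite !gnorm.
have comm_conj (z : T) : commute (gen u) z -> z = (gen u)^-1 * z * gen u.
  by move=> uz; rewrite -mulgA -uz mulKg.
have [ux|nux] := pselect (beyond u x); have [uy|nuy] := pselect (beyond u y).
- by rewrite !foldT // => /conjK ?; constructor 1.
- have [cy|ncy] := pselect (commute (gen u) y); last by constructor 2.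
  rewrite foldT // foldF // {1}(comm_conj y cy) => /conjK ?; by constructor 1.
- have [cx|ncx] := pselect (commute (gen u) x); last by constructor 3.
  rewrite foldF // foldT // {1}(comm_conj x cx) => /conjK ?; by constructor 1.
- by rewrite !foldF // => ?; constructor 1.
Qed.

Lemma commute_gen_pos u (x : T) : commute (gen (u.1, false)) x <-> commute (gen u) x.
Proof.
rewrite (gen_sign u); case: u.2 => //; split=> /commute_sym c; apply/commute_sym.
  exact: commuteV.
by rewrite -[gen _]invgK; apply: commuteV.
Qed.

Lemma fold_comm_inv u (x : T) : commute (gen u) (fold u x) -> commute (gen u) x.
Proof.
have [ux|nux] := pselect (beyond u x); last by rewrite foldF.
rewrite foldT // /commute -!mulgA mulVKg => E.
by apply: (mulgI (gen u)^-1); apply: (mulIg (gen u)); rewrite mulKg -!mulgA.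
Qed.

(* If [Q] holds at two consecutive indices, a maximal arc of the hole on which it
   holds is closed up to a hole by the vertex [u] itself. *)
Lemma fold_arc (u : letter G) m (h : nat -> T) (Q : pred nat) q i :
  5 <= m -> hole (@ext_adj G) m h ->
  (forall k, Q (k + m)%N = Q k) ->
  (forall k, Q k -> ~~ Q k.+1 -> commute (gen u) (h k.+1)) ->
  (forall k, ~~ Q k -> Q k.+1 -> commute (gen u) (h k)) ->
  (forall k, Q k -> ~ commute (gen u) (h k)) ->
  (forall k l, Q k -> Q l -> ext_adj (fold u (h k)) (fold u (h l)) -> ext_adj (h k) (h l)) ->
  ~~ Q q -> ~ commute (gen u) (h q) -> Q i -> Q i.+1 ->
  exists m' g, [/\ 5 <= m' <= m, hole (@ext_adj G) m' g &
    \sum_(i < m') len (g i) <= \sum_(i < m) len (fold u (h i))].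
Proof.
move=> m5 hh perQ out into QJ mix nQq nJq Qi Qi1.
have symE := @ext_adj_sym G; have [per con non] := hh.
have [|||||r [k [k1 km Jr Je Qin]]] :=
  @periodic_arc Q (fun k => `[< commute (gen u) (h k) >]) m q i _ perQ _ _ _ nQq _ Qi Qi1.
- by lia.
- by move=> k; rewrite per.
- by move=> k *; apply/asboolP/out.
- by move=> k *; apply/asboolP/into.
- exact/asboolPn.
move: Jr Je => /asboolP Jr /asboolP Je.
pose v : T := gen (u.1, false).
have vfix x : commute (gen u) x -> fold u x = x := @fold_comm _ u x.
have rep_h j : exists g, rep (h j) g by have [g] := ext_adj_rep (con j); exists g.
have vadj j l : commute (gen u) (h j) -> ~ commute (gen u) (h l) -> ext_adj (h j) (h l) ->
    ext_adj (fold u (h j)) v.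
  move=> Jj nJl jl; rewrite vfix //; have [g jg] := rep_h j.
  have rv : rep v 1 by exists u.1; rewrite !gnorm.
  have [|vj|//] := ext_adj_of_comm jg rv; first exact/commute_sym/commute_gen_pos.
  by case: nJl; apply/commute_gen_pos; rewrite -/v -vj; apply: ext_adj_comm.
have Qk j : 0 < j -> j <= k -> Q (r + j)%N by move=> j0 jk; apply: Qin; rewrite j0.
(* The new cycle follows the folded arc with both its ends and returns through [v], which has length
   [0] and so adds nothing to the sum. *)
pose g j := if j < k.+2 then fold u (h (r + j)%N) else v.
exists (k + 3)%N, (fun j => g (j %% (k + 3))); split.
- by lia.
- apply: hole_of_prefix => // [|j jk||j l jl lk edge].
  + by lia.
  + rewrite /g; have -> : j < k.+2 by lia.
    case: ltnP => j2; first by rewrite addnS; apply: fold_ext_adj.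
    have -> : j = k.+1 by lia.
    apply: (@vadj _ (r + k)); [exact: Je | by apply/QJ/Qk; lia | ].
    by rewrite addnS; apply/symE/con.
  + rewrite /g addn3 ltnn /=; apply/symE/(@vadj _ (r + 1)); rewrite ?addn0 ?addn1 //.
    by apply: QJ; rewrite -addn1; apply: Qk; lia.
  rewrite /g; have -> : j < k.+2 by lia.
  case: ltnP => l2 a; last first.
    have Qj : Q (r + j)%N by apply: Qk; lia.
    apply: (QJ _ Qj); apply: fold_comm_inv.
    by apply/commute_gen_pos/commute_sym/ext_adj_comm.
  have nadj : ~ ext_adj (h (r + j)%N) (h (r + l)%N).
    have -> : (r + l)%N = (r + j + (l - j))%N by lia.
    by apply: non; lia.
  have JJ : ~ commute (gen u) (h (r + j)%N) -> ~ commute (gen u) (h (r + l)%N) -> False.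
    move=> nJj nJl; apply/nadj/mix => //; apply: Qk; rewrite ?lt0n; try lia.
    - by apply/eqP => j0; apply: nJj; rewrite j0 addn0.
    - have : l != k.+1 by apply/eqP => E; apply: nJl; rewrite E.
      by lia.
  have [gj rj] := rep_h (r + j)%N; have [gl rl] := rep_h (r + l)%N.
  case: (fold_ext_adj_inv a) => [//|[b _ nJ]|[b _ nJ]]; apply: JJ => //.
    exact: beyond_ncomm rj b.
  exact: beyond_ncomm rl b.
have -> : \sum_(i < k + 3) len (g (i %% (k + 3))) = \sum_(i < k.+2) len (fold u (h (i + r)%N)).
  rewrite addn3 big_ord_recr /= modn_small // {2}/g ltnn len_gen addn0.
  by apply: eq_bigr => j _; rewrite modn_small /g ?ltn_ord ?(leq_trans (ltn_ord j)) // addnC.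
rewrite -(@sum_shift (fun j => len (fold u (h j))) m r) => [|j]; last by rewrite per.
by apply: (@sum_prefix (fun j => len (fold u (h (j + r)%N)))); lia.
Qed.

Lemma fold_broken (u : letter G) m (h : nat -> T) d :
  5 <= m -> hole (@ext_adj G) m h -> 2 <= d -> d.+2 <= m ->
  beyond u (h 0) -> ~ beyond u (h d) -> ~ commute (gen u) (h d) ->
  ext_adj (fold u (h 0)) (fold u (h d)) ->
  exists m' g, [/\ 5 <= m' <= m, hole (@ext_adj G) m' g &
    \sum_(i < m') len (g i) <= \sum_(i < m) len (fold u (h i))].
Proof.
move=> m5 hh d2 dm I0 nId nJd a0d; have [per con non] := hh.
have symE := @ext_adj_sym G.
have rep_h j : exists g, rep (h j) g by have [g] := ext_adj_rep (con j); exists g.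
have IJ k : beyond u (h k) -> ~ commute (gen u) (h k).
  by have [g rg] := rep_h k; apply: beyond_ncomm rg.
(* [I] marks the vertices beyond the wall and [K] those not beyond it that do not commute with
   [gen u]; all others commute with [gen u]. *)
pose I k := `[< beyond u (h k) >].
pose K k := ~~ I k && ~~ `[< commute (gen u) (h k) >].
have [[i /andP[/asboolP Ii /asboolP Ii1]]|nI] := pselect (exists i, I i && I i.+1).
  apply: (@fold_arc u m h I d i) => //; rewrite /I.
  - by move=> k; rewrite per.
  - by move=> k /asboolP Ik /asboolPn nIk; apply: beyond_ext_adj (con k) Ik nIk.
  - by move=> k /asboolPn nIk /asboolP Ik; apply: beyond_ext_adj (symE _ _ (con k)) Ik nIk.
  - by move=> k /asboolP/IJ.
  - move=> k l /asboolP Ik /asboolP Il; case/fold_ext_adj_inv=> // -[] //.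
  - exact/asboolPn.
  - exact/asboolP.
  - exact/asboolP.
have [[i /andP[Ki Ki1]]|nK] := pselect (exists i, K i && K i.+1).
  apply: (@fold_arc u m h K 0 i) => //; rewrite /K.
  - by move=> k; rewrite /I per.
  - move=> k /andP[/asboolPn nIk /asboolPn nJk]; rewrite negb_and !negbK => /orP[] /asboolP // Ik.
    by case: nJk; apply: beyond_ext_adj (symE _ _ (con k)) Ik nIk.
  - move=> k + /andP[/asboolPn nIk /asboolPn nJk]; rewrite negb_and !negbK => /orP[] /asboolP // Ik.
    by case: nJk; apply: beyond_ext_adj (con k) Ik nIk.
  - by move=> k /andP[_ /asboolPn].
  - move=> k l /andP[/asboolPn nIk _] /andP[/asboolPn nIl _].
    by case/fold_ext_adj_inv=> // -[].
  - by rewrite negb_and negbK /I asboolT.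
  - exact: IJ.
have Kd : K d by apply/andP; split; apply/asboolPn.
have Jd1 : commute (gen u) (h d.+1).
  have : ~~ K d.+1 by apply/negP => Kd1; apply: nK; exists d; rewrite Kd Kd1.
  rewrite negb_and !negbK => /orP[] /asboolP // Ik.
  by case: nJd; apply: beyond_ext_adj (symE _ _ (con d)) Ik nId.
have hm : h m = h 0 by rewrite -[m]add0n per.
have con' : ext_adj (h m.-1) (h 0) by rewrite -hm -{2}(@prednK m) //; lia.
have Jm1 : commute (gen u) (h m.-1).
  apply: (beyond_ext_adj (symE _ _ con') I0) => Im1; apply: nI; exists m.-1.
  by rewrite prednK ?[I m]/I ?hm; [rewrite /I !asboolT | lia].
have dm1 : d.+1 != m.-1.
  apply/eqP => E; have := fold_ext_adj u con'; rewrite -E => c.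
  exact: (ext_adjT c a0d) (symE _ _ (fold_ext_adj u (con d))).
pose v : T := gen (u.1, false).
have rv : rep v 1 by exists u.1; rewrite !gnorm.
have vadj j l : commute (gen u) (h j) -> ~ commute (gen u) (h l) -> ext_adj (h j) (h l) ->
    ext_adj (fold u (h j)) v.
  move=> Jj nJl jl; rewrite fold_comm //; have [g jg] := rep_h j.
  have [|vj|//] := ext_adj_of_comm jg rv; first exact/commute_sym/commute_gen_pos.
  by case: nJl; apply/commute_gen_pos; rewrite -/v -vj; apply: ext_adj_comm.
have vd := vadj _ _ Jd1 nJd (symE _ _ (con d)).
have vm := vadj _ _ Jm1 (IJ _ I0) con'.
(* The new edge, its outer neighbours [d.+1] and [m.-1], and [v] form a pentagon. By [dm1] four
   distinct indices of the old hole occur, which bounds the sum of lengths. *)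
have h5 := hole5 symE ext_adjT a0d (fold_ext_adj u (con d)) vd (symE _ _ vm) (fold_ext_adj u con').
exists 5; eexists; split; [by lia | exact: h5 |].
apply: leq_trans (@sum_uniq_le (fun i => len (fold u (h i))) [:: 0; d; d.+1; m.-1] m _ _).
- rewrite !big_ord_recl big_ord0 !big_cons big_nil /= /bump /=.
  by rewrite len_gen; lia.
- by rewrite /= !inE; lia.
- by rewrite /=; lia.
Qed.

(** If the fold creates an edge, the hole is rotated so that the endpoint beyond the wall has index
    [0], and a possibly shorter hole is extracted. *)
Lemma fold_step (u : letter G) m (f : nat -> T) :
  5 <= m -> hole (@ext_adj G) m f ->
  exists m' g, [/\ 5 <= m' <= m, hole (@ext_adj G) m' g &
    \sum_(i < m') len (g i) <= \sum_(i < m) len (fold u (f i))].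
Proof.
move=> m5 hf; have esym := @ext_adj_sym G.
have [hf'|nhf'] := pselect (hole (@ext_adj G) m (fun i => fold u (f i))).
  by exists m, (fun i => fold u (f i)); split; rewrite ?m5 ?leqnn.
have [p [d [d2 dm [Ip nId nJd] adj0d]]] : exists p d, [/\ 2 <= d, d.+2 <= m,
    [/\ beyond u (f p), ~ beyond u (f (p + d)%N) & ~ commute (gen u) (f (p + d)%N)] &
    ext_adj (fold u (f p)) (fold u (f (p + d)%N))].
  case: (hf) => per con non.
  apply: contrapT => nex; apply: nhf'; split=> [i|i|i d d2 dm a].
  - by rewrite per.
  - by apply: fold_ext_adj; apply: con.
  have [a'|c|c] := fold_ext_adj_inv a; first exact: non a'.
    by apply: nex; exists i, d.
  apply: nex; exists (i + d)%N, (m - d)%N; have E : f (i + d + (m - d))%N = f i.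
    by rewrite -addnA subnKC ?per //; lia.
  rewrite !E; split=> //; [lia | lia | exact: esym].
rewrite -(@sum_shift (fun i => len (fold u (f i))) m p) => [|i]; last by case: hf => ->.
apply: (fold_broken m5 (hole_shift p hf) d2 dm) => //; by rewrite [(d + p)%N]addnC.
Qed.

End Fold.

Section ExtHole.
Variable G : sgraph.
Local Notation T := (raag G).
Hypothesis tf : triangleless G.

Lemma ext_adj_gen (a b : G) :
  ext_adj (gen (a, false) : T) (gen (b, false)) <-> adj a b.
Proof.
have conj1 c : (gen (c, false) : T) = 1 * gen (c, false) * 1^-1 by rewrite !gnorm.
split=> [[g [a' [b' [ab' E1 E2]]]]|ab_]; last by exists 1, a, b; rewrite -!conj1.
by rewrite conj1 in E1; rewrite conj1 in E2; rewrite (conj_gen_inj E1) (conj_gen_inj E2).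
Qed.

(** Induction on the total length: folding along a wall with some vertex beyond it lowers the total,
    and vertices of length [0] are generators. *)
Lemma hole_of_ext_hole m (f : nat -> T) : 5 <= m -> hole (@ext_adj G) m f ->
  exists m' f', 5 <= m' <= m /\ hole (fun a b : G => adj a b) m' f'.
Proof.
have [N leN] := ubnP (\sum_(i < m) len (f i)).
elim: N m f leN => // N IHN m f leN m5 hf; have [per con non] := hf.
have rep_f i : exists g, rep (f i) g by have [g] := ext_adj_rep (con i); exists g.
have [[i li]|nl] := pselect (exists i, 0 < len (f i)).
  have [g rg] := rep_f i; have [u ui] := beyond_ex rg li.
  have [m' [f' [m'm hf' sm']]] := fold_step tf u m5 hf.
  have [||m'' [f'' [m''m hf'']]] := IHN m' f' _ _ hf'; [|by lia|].
    apply: leq_ltn_trans sm' _; rewrite -ltnS; apply: leq_trans leN.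
    rewrite ltnS -(@sum_shift (fun i => len (f i)) m i) => [|j]; last by rewrite per.
    rewrite -(@sum_shift (fun i => len (fold u (f i))) m i) => [|j]; last by rewrite per.
    case: (m) m5 => // k _; rewrite !big_ord_recl /= add0n -addSn.
    apply: leq_add; first exact: len_beyond rg ui.
    by apply: leq_sum => j _; have [g' rg'] := rep_f (bump 0 j + i)%N; apply: len_fold rg'.
  by exists m'', f''; split=> //; lia.
have fgen i : exists a, f i = gen (a, false).
  have [g rg] := rep_f i; apply: len0 rg _; apply/eqP; rewrite -leqn0 leqNgt.
  by apply/negP => li; apply: nl; exists i.
have [a fa] := choice fgen; exists m, a; split; first by rewrite m5 leqnn.
split=> [i|i|i d d2 dm].
- have := per i; rewrite !fa => /(congr1 (ab (a i))); rewrite !ab_gen /= eqxx.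
  by case: eqP.
- by apply/ext_adj_gen; rewrite -!fa.
- by move/ext_adj_gen; rewrite -!fa; apply: non.
Qed.

End ExtHole.

(** * Embeddings *)

Lemma triangle_free_triangleless (G : sgraph) : triangle_free G -> triangleless G.
Proof.
move=> tf a b c ab_ bc; apply/negP => ac.
have neq x y : adj x y -> x != y by apply: contraTneq => ->; rewrite adj_irrefl.
have := tf [:: a; b; c]; rewrite /ucycle /= ab_ bc adj_sym ac /=.
by rewrite !inE !negb_or !neq // => /(_ isT).
Qed.

Lemma bipartite_triangleless (G : sgraph) : bipartite G -> triangleless G.
Proof.
case=> side sideP a b c /sideP + /sideP ; case: (boolP (adj a c)) => // /sideP.
by case: (side a); case: (side b); case: (side c).
Qed.

Section Embedding.
Variables (G L : sgraph) (phi : {multiplicative raag L -> raag G}).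
Hypothesis phi_inj : injective phi.
Hypothesis tf : triangleless G.

Definition img (x : L) : raag G := phi (gen (x, false)).

Lemma phi1 : phi 1 = 1.
Proof. by apply: (mulgI (phi 1)); rewrite -gmulfM !mulg1. Qed.

Lemma phiV x : phi x^-1 = (phi x)^-1.
Proof. by apply/esym/mulg1_eq; rewrite -gmulfM mulgV phi1. Qed.

Lemma phiX x n : phi (x ^+ n) = phi x ^+ n.
Proof. by elim: n => [|n IHn]; rewrite ?expg0 ?phi1 // !expgS gmulfM IHn. Qed.

Lemma img_comm x y : adj x y -> commute (img x) (img y).
Proof. by move=> /(@gen_comm L (x, false) (y, false)) E; rewrite /commute -!gmulfM E. Qed.

Lemma img_ncomm x y p q : x != y -> ~~ adj x y -> 0 < p -> 0 < q ->
  ~ commute (img x ^+ p) (img y ^+ q).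
Proof.
move=> xy nxy p0 q0; rewrite /commute /img -!phiX -!gmulfM => /phi_inj.
exact: gen_power_noncommuting.
Qed.

Lemma img_indep x y p q1 q2 : x != y -> 0 < p ->
  img x ^+ p * (img y ^+ q1 * (img y ^+ q2)^-1) <> 1.
Proof.
move=> xy p0; rewrite /img -!phiX -phiV -!gmulfM -phi1 => /phi_inj.
move/(congr1 (ab x)); rewrite !(abM, abV, abX, ab_gen, ab1) /= eqxx eq_sym (negPf xy); lia.
Qed.

(** [S i] is the support of the image of [h i]. Consecutive supports are joined by
    [neighbour_fixes]; completeness at a larger distance would make the images commute, and an empty
    support would make an image central. *)
Lemma img_complete_hole n h : 5 <= n -> hole (fun x y : L => adj x y) n h ->
  exists S : nat -> seq (raag G),
    (forall i, S i != [::]) /\ hole (complete (@ext_adj G)) n S.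
Proof.
move=> n5 hh; have [per con non] := hh.
have [s sP] := choice (fun x => skew_support (img x)).
have nc i d p q : 2 <= d -> d.+2 <= n -> 0 < p -> 0 < q ->
    ~ commute (img (h i) ^+ p) (img (h (i + d)%N) ^+ q).
  move=> d2 dn p0 q0; apply: img_ncomm => //; last by apply/negP/non.
  by apply/eqP; apply: hole_neq hh _ _.
have nc1 i d : 2 <= d -> d.+2 <= n -> ~ commute (img (h i)) (img (h (i + d)%N)).
  by move=> d2 dn; have := nc i d 1%N 1%N d2 dn isT isT; rewrite !expg1.
exists (fun i => s (h i)); split=> [i|].
  apply/eqP => si; have [_] := sP (h i); rewrite si => /(_ (img (h (i + 2)%N))) c.
  by apply: (nc1 i 2) => //; [lia | apply/commute_sym/c].
split=> [i|i x y|i d d2 dn c]; first by rewrite per.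
  case/(proj1 (sP _)) => H Hw -> /(proj1 (sP _))[K Kh ->].
  have adjn j : adj (h j) (h j.+1) by apply: con.
  (* The index [i + n.-1] stands for the predecessor of [i]. *)
  have hin : h (i + n.-1).+1 = h i by rewrite -addnS prednK ?per //; lia.
  have nb := @neighbour_fixes G
    (img (h i)) (img (h i.+1)) (img (h i.+2)) (img (h (i + n.-1)%N)) H tf.
  suff fx : fixes (img (h i.+1)) H by have [] := fixes_skew_crossing fx Kh.
  apply: nb => //.
  - by apply/commute_sym/img_comm.
  - by apply/commute_sym/img_comm.
  - by rewrite -[in X in commute _ X]hin; apply/img_comm.
  - move=> p q p0 q0 /commute_sym; rewrite -[i.+2]addn2; apply: nc => //; lia.
  - move=> p q p0 q0; have -> : i.+1 = (i + 1)%N by lia.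
    have -> : h (i + 1)%N = h (i + n.-1 + 2)%N by rewrite -[LHS]per; congr h; lia.
    by apply: nc => //; lia.
  - move=> p q1 q2 p0; apply: img_indep => //; apply: contraTneq (adjn i) => ->.
    by rewrite adj_irrefl.
apply: (nc1 i d) => //.
have [_ c1] := sP (h i); have [_ c2] := sP (h (i + d)%N).
apply: c2 => x xs; apply/commute_sym/c1 => y ys; apply/commute_sym.
exact/ext_adj_comm/c.
Qed.

End Embedding.

(** * Induced cycles and odd closed walks *)

Lemma hole_induced_cycle (G : sgraph) m (f : nat -> G) :
  5 <= m -> hole (fun a b : G => adj a b) m f ->
  exists S : {set G}, graph_iso (induced S) (cycle_graph m).
Proof.
move=> m5 hf; have [per con non] := hf.
have fm : f m = f 0 by rewrite -[m]add0n per.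
have lt_adj i j : i < j -> j < m -> adj (f i) (f j) = (j == i.+1) || ((i == 0) && (j == m.-1)).
  move=> ij jm; case: eqVneq => [->|ji] /=; first by rewrite con.
  have [/andP[/eqP-> /eqP->]|edge] := boolP ((i == 0) && (j == m.-1)).
    by rewrite adj_sym -fm -{2}(@prednK m) ?con //; lia.
  by apply/negP; apply: (hole_lt hf); move: edge; lia.
have lt_neq i j : i < j -> j < m -> f i <> f j.
  move=> ij jm E; have := lt_adj _ _ ij jm; rewrite E adj_irrefl => /esym/negbT.
  rewrite negb_or => /andP[ji edge].
  case: (@hole_neq _ _ m f i (j - i) m5 hf); [lia | lia |].
  by rewrite subnKC // ltnW.
have f_inj i j : i < m -> j < m -> f i = f j -> i = j.
  by move=> im jm E; case: (ltngtP i j) => // ij; [case: (lt_neq _ _ ij) | case: (lt_neq _ _ ij)].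
pose S := [set f i | i : 'I_m]; exists S.
have fS (i : cycle_graph m) : f (i : 'I_m) \in S by apply/imsetP; exists i.
pose F (i : cycle_graph m) : induced S := exist _ (f (i : 'I_m)) (fS i).
have F_inj : injective F.
  by move=> i j /(congr1 val) /= /f_inj E; apply/val_inj/E; apply: ltn_ord.
have [|g Fg gF] := @inj_card_bij _ _ F F_inj.
  have -> : #|induced S| = #|S| by rewrite card_sig; apply: eq_card.
  exact: leq_imset_card.
exists g; first by exists F.
have ltE (i j : 'I_m) : i < j -> cycle_adj i j = adj (f i) (f j).
  move=> ij; have jm := ltn_ord j; rewrite lt_adj // /cycle_adj -!val_eqE /=.
  rewrite (modn_small (leq_ltn_trans ij jm)) neq_ltn ij /=; congr (_ || _).
  have [j1|j1] := ltnP j.+1 m; first by rewrite modn_small //; lia.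
  have -> : j.+1 = m by lia.
  by rewrite modnn; lia.
have cE (i j : 'I_m) : cycle_adj i j = adj (f i) (f j).
  case: (ltngtP i j) => [|ij|/val_inj->]; first exact: ltE.
    by rewrite cycle_adj_sym adj_sym ltE.
  by rewrite cycle_adj_irrefl adj_irrefl.
by move=> x y; rewrite -{2}[x]gF -{2}[y]gF /= cE.
Qed.

(** A chord of a shortest odd closed walk splits it into closed walks of lengths [d + 1] and
    [n - d + 1]. Both are shorter, and one is odd. *)
Lemma min_odd_walk_hole (L : sgraph) n (h : nat -> L) :
  odd n -> closed_walk (fun x y : L => adj x y) n h ->
  exists n' h', [/\ odd n', 3 <= n' & hole (fun x y : L => adj x y) n' h'].
Proof.
pose P n := `[< odd n /\ exists h, closed_walk (fun x y : L => adj x y) n h >].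
move=> on hn; have exP : exists n, P n by exists n; apply/asboolP; split=> //; exists h.
case: (ex_minnP exP) => {n h on hn exP} n /asboolP[on [h [per con]]] minn.
have n3 : 3 <= n.
  case: n on per con {minn} => [|[|[|n]]] // _ per con.
  by have := con 0; rewrite (per 0 : h 1%N = h 0) adj_irrefl.
exists n, h; split=> //; split=> // i d d2 dn a.
have small k (w : nat -> L) : odd k -> k < n ->
    (forall i, i.+1 < k -> adj (w i) (w i.+1)) -> adj (w k.-1) (w 0) -> False.
  move=> ok kn cw lw; have : n <= k; last by lia.
  apply: minn; apply/asboolP; split=> //; exists (fun i => w (i %% k)).
  by apply: closed_walk_of_prefix => //; apply: odd_gt0.
have [od|ed] := boolP (odd d).
  apply: (small (n - d).+1 (fun j => h (i + d + j)%N)).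
  - by rewrite /= oddB ?on ?od //; lia.
  - by lia.
  - by move=> j _; rewrite addnS.
  - by rewrite /= addn0 -addnA subnKC ?per //; lia.
apply: (small d.+1 (fun j => h (i + j)%N)) => //.
- by move=> j _; rewrite addnS.
- by rewrite /= addn0 adj_sym.
Qed.

Section DoubleCover.
Variable L : sgraph.

(** The bipartite double cover of [L]. *)
Definition double_adj : rel (L * bool) := fun x y => adj x.1 y.1 && (x.2 != y.2).

Lemma double_sym : connect_sym double_adj.
Proof. by apply: sym_connect_sym => x y; rewrite /double_adj adj_sym eq_sym. Qed.

Lemma double_path x p : path double_adj x p -> (last x p).2 = x.2 (+) odd (size p).
Proof.
elim: p x => [|y p IHp] x /=; first by rewrite addbF.
by case/andP=> /andP[_ xy] /IHp ->; case: x.2 y.2 xy (odd _) => [] [] // _ [].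
Qed.

Lemma double_lift x p b : path (@adj L) x p ->
  exists c, connect double_adj (x, b) (last x p, c).
Proof.
elim: p x b => [|y p IHp] x b /=; first by exists b; apply: connect0.
case/andP=> xy /(IHp _ (~~ b))[c yc]; exists c; apply: connect_trans yc.
by apply: connect1; rewrite /double_adj /= xy; case: b.
Qed.

(** A path joining the two lifts of a vertex projects to an odd closed walk. If there is none, the
    lift reachable from a lift of the root of the component gives a 2-colouring. *)
Lemma odd_walk_of_not_bipartite : ~ bipartite L ->
  exists n h, odd n /\ closed_walk (fun x y : L => adj x y) n h.
Proof.
move=> nbip; apply: contrapT => nodd; apply: nbip.
have nflip x : ~~ connect double_adj (x, false) (x, true).
  apply/negP => /connectP[p xp xl]; apply: nodd.
  have op : odd (size p) by have := double_path xp; rewrite -xl.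
  pose w j := (nth (x, false) ((x, false) :: p) j).1.
  exists (size p), (fun i => w (i %% size p)); split=> //.
  have step j : j < size p -> adj (w j) (w j.+1).
    by move=> jp; have /andP[] := pathP (x, false) xp j jp.
  apply: closed_walk_of_prefix => [|j jp|]; first exact: odd_gt0.
    by apply: step; apply: ltnW.
  have -> : w 0 = w (size p).
    by rewrite /w /= -[size p]/(size ((x, false) :: p)).-1 nth_last /= -xl.
  rewrite -{2}(prednK (odd_gt0 op)); apply: step; rewrite prednK //; exact: odd_gt0.
have asym : connect_sym (@adj L) by apply/sym_connect_sym/adj_sym.
pose side x := connect double_adj (root (@adj L) x, false) (x, true).
exists side => x y xy; rewrite /side.
have -> : root (@adj L) y = root (@adj L) x.
  by apply/esym/(rootP asym)/connect1.
set r := root _ x.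
have step a b c : adj a b -> connect double_adj (r, false) (a, c) ->
    connect double_adj (r, false) (b, ~~ c).
  move=> ab_ rc; apply: connect_trans rc _; apply: connect1.
  by rewrite /double_adj /= ab_; case: c.
have noboth a : connect double_adj (r, false) (a, false) ->
    connect double_adj (r, false) (a, true) -> False.
  move=> r1 r2; case/negP: (nflip a); apply: connect_trans r2.
  by rewrite double_sym.
have [p rp xl] : exists2 p, path (@adj L) r p & x = last r p.
  by apply/connectP; rewrite asym; apply: connect_root.
have [b] := double_lift false rp; rewrite -xl; case: b => rx.
  rewrite rx; apply/eqP => /esym ry; exact: noboth (step _ _ _ xy rx) ry.
rewrite (step _ _ _ xy rx); apply/eqP => rx'; exact: noboth rx rx'.
Qed.

End DoubleCover.

(** * Embeddings into bipartite graphs' groups *)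

Section Bipartite.
Variables (G L : sgraph) (phi : {multiplicative raag L -> raag G}).
Hypothesis phi_inj : injective phi.

(** The vertices of a triangle have commuting images; their independence is checked in the source by
    exponent sums. *)
Lemma embeds_triangleless : triangleless G -> triangleless L.
Proof.
move=> tf a b c ab_ bc; apply/negP => ac.
have neq (x y : L) : adj x y -> x != y by apply: contraTneq => ->; rewrite adj_irrefl.
have [ba ca cb] : [/\ b != a, c != a & c != b].
  by split; rewrite eq_sym neq.
apply: (@no_rank_three G (img phi a) (img phi b) (img phi c) tf).
- by apply: img_comm; rewrite adj_sym.
- by apply: img_comm; rewrite adj_sym.
- by apply: img_comm; rewrite adj_sym.
- rewrite -(phi1 phi) => /phi_inj /(congr1 (ab a)).
  by rewrite ab_gen ab1 /= eqxx.
- by move=> p q1 q2; apply: img_indep.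
move=> p q1 q2 p' q1' q2' p'' q1'' q2'' p0 p0'.
rewrite /img -!(phiX, phiV, gmulfM) -(phi1 phi) => /phi_inj /(congr1 (ab c)).
rewrite !(abM, abV, abX, ab_gen, ab1) /= eqxx ![_ == c]eq_sym (negPf ca) (negPf cb).
by nia.
Qed.

Lemma embeds_bipartite : bipartite G -> bipartite L.
Proof.
move=> bip; have tf := bipartite_triangleless bip; apply: contrapT => nb.
have [n [h [on hw]]] := odd_walk_of_not_bipartite nb.
have [{on hw h} n' [h [on n3 hh]]] := min_odd_walk_hole on hw.
have [per con non] := hh.
have n5 : 5 <= n'.
  case: n' on n3 per {con non hh} (con) => [|[|[|[|[|n']]]]] //= _ _ per con.
  have := embeds_triangleless tf (con 0) (con 1%N).
  by rewrite -(per 0 : h 3 = h 0) adj_sym con.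
have [S [S0 [perS conS _]]] := img_complete_hole phi_inj tf n5 hh.
(* The choice depends only on the list [S i], so [x] inherits the period [n']; the default [1] never
   occurs. *)
pose x i := head 1 (S i).
have xS i : x i \in S i by rewrite /x; case: (S i) (S0 i) => // y s _; apply: mem_head.
have xadj i : ext_adj (x i) (x i.+1) by apply: conS.
have exT i : exists a g, x i = g * gen (a, false) * g^-1.
  by have [g [a [b [_ -> _]]]] := xadj i; exists a, g.
have [t tP] := choice exT.
case: bip => side sideP.
have step i : side (t i.+1) = ~~ side (t i).
  have [g [a [b [ab_ E1 E2]]]] := xadj i; have [g1 F1] := tP i; have [g2 F2] := tP i.+1.
  have -> : t i = a by apply: (@conj_gen_inj G _ _ g1 g); rewrite -F1.
  have -> : t i.+1 = b by apply: (@conj_gen_inj G _ _ g2 g); rewrite -F2.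
  by have := sideP _ _ ab_; case: (side a); case: (side b).
have sideE i : side (t i) = odd i (+) side (t 0).
  by elim: i => //= i IHi; rewrite step IHi addNb.
have tn : t n' = t 0.
  have [g1 F1] := tP n'; have [g2 F2] := tP 0; apply: (@conj_gen_inj G _ _ g1 g2).
  by rewrite -F1 -F2 /x -[n']add0n perS.
by have := sideE n'; rewrite tn on; case: (side _).
Qed.

End Bipartite.

Theorem corollary48 (G : sgraph) (n : nat) (hn : 5 <= n) :
  (triangle_free G -> embeds (raag (cycle_graph n)) (raag G) ->
     exists m : nat, 5 <= m <= n /\
       exists S : {set G}, graph_iso (induced S) (cycle_graph m)) /\
  (bipartite G ->
     forall L : sgraph, embeds (raag L) (raag G) -> bipartite L).
Proof.
split=> [/triangle_free_triangleless tf|bip L] [phi phi_inj];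
  last exact: embeds_bipartite phi_inj bip.
have n0 : 0 < n by lia.
pose h i : cycle_graph n := Ordinal (ltn_pmod i n0).
have hh : hole (fun x y : cycle_graph n => adj x y) n h.
  have -> : h = (fun i => h (i %% n)).
    by apply: functional_extensionality_dep => i; apply: val_inj; rewrite /= modn_mod.
  have E i j : i < n -> j < n -> adj (h i) (h j) =
    (i != j) && ((j == i.+1 %% n) || (i == j.+1 %% n)).
    by move=> li lj; rewrite /= /cycle_adj -!val_eqE /= (modn_small li) (modn_small lj).
  apply: hole_of_prefix => // [x y|i li||i j ij jn edge].
  - by rewrite adj_sym.
  - by rewrite E // ?(ltnW li) // (modn_small li) eqxx andbT; lia.
  - by rewrite E //; [rewrite prednK // modnn eqxx andbT; lia | lia].
  have il : i.+1 < n by lia.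
  rewrite E //; [| by lia]; rewrite (modn_small il).
  have [j1|j1] := ltnP j.+1 n; first by rewrite (modn_small j1); lia.
  have -> : j.+1 = n by lia.
  by rewrite modnn; lia.
have [S [S0 hS]] := img_complete_hole phi_inj tf hn hh.
have [m [f [mn hf]]] :=
  hole_of_complete_hole (@ext_adj_sym G) (fun x y z => @ext_triangleless G x y z tf) hn S0 hS.
have [|m' [f' [m'm hf']]] := hole_of_ext_hole tf _ hf; first by lia.
exists m'; split; first by lia.
by apply: hole_induced_cycle hf'; lia.
Qed.
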